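(* Let $a\in\mathbb R^d$ ($d\ge2$), $\mathcal X=[a,\infty)$, and $\mathcal F=\{f:0\le f(x)\le(Mg_0(x))^{1/(1-\gamma)}\ \forall x\in\mathcal X,\ f\text{ is orthounimodal about }a\text{ on }\mathcal X\}$, where $M>0$, $\gamma\in(0,1)$, and $g_0$ is a positive orthounimodal (about $a$) probability density on $\mathcal X$ with $g_0(a)<\infty$. Let $g_0$ be the sampling distribution. Suppose $\|\phi_j\|_{1+\delta}<\infty$ for $j=0,\ldots,l$ and some $\delta>0$, and that there exists $L_0\in\mathcal L$ such that $\mathbb E_{g_0}[\phi_j(X)L_0(X)]<\mu_j$ for $j=1,\ldots,m$ and $\mathbb E_{g_0}[\phi_j(X)L_0(X)]=\mu_j$ for $j=m+1,\ldots,l$, with moreover $(\mu_{m+1},\ldots,\mu_l)$ an interior point of $\{(\mathbb E_{g_0}[\phi_{m+1}(X)L(X)],\ldots,\mathbb E_{g_0}[\phi_l(X)L(X)]):L\in\mathcal L\}$. Then the problem $(\mathcal P_n)$ is equivalent to the linear program $(\mathcal P_n')$ (i.e. $(\mathcal P_n)$ is finite-dimensionally reducible) with the discrete shape constraint $$L(X_i)g_0(X_i)\le L(X_j)g_0(X_j)\ \text{ if }X_i\ge X_j\text{ component-wise},\qquad 0\le L(X_i)g_0(X_i)\le(Mg_0(X_i))^{1/(1-\gamma)},\ i=1,\ldots,n.$$ Additionally, $|val(\mathcal P_n)-val(\mathcal P)|\overset{\text{a.s.*}}{\to}0$.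
   Context: Setting. $\phi_0,\ldots,\phi_l:\mathcal X\to\mathbb R$ are known functions, $0\le m\le l$, $\mu_1,\ldots,\mu_l\in\mathbb R$, and one of $\phi_1,\ldots,\phi_l$ is the indicator $I(x\in\mathcal X)$ (total mass constraint). $X,X_1,X_2,\ldots$ are i.i.d. with density $g_0$, $\mathbb E_{g_0}$ is expectation under $g_0$, $\|h\|_p=(\mathbb E_{g_0}|h(X)|^p)^{1/p}$, and $\mathcal L=\{f/g_0:f\in\mathcal F\}$. Problem $(\mathcal P)$: $\sup_{L\in\mathcal L}\mathbb E_{g_0}[\phi_0(X)L(X)]$ subject to $\mathbb E_{g_0}[\phi_j(X)L(X)]\le\mu_j$ for $j=1,\ldots,m$ and $\mathbb E_{g_0}[\phi_j(X)L(X)]=\mu_j$ for $j=m+1,\ldots,l$. Problem $(\mathcal P_n)$ (the IW-SAA problem): $\sup_{L\in\mathcal L}\frac1n\sum_{i=1}^n\phi_0(X_i)L(X_i)$ subject to $\frac1n\sum_{i=1}^n\phi_j(X_i)L(X_i)\le\mu_j$ for $j=1,\ldots,m$ and $\frac1n\sum_{i=1}^n\phi_j(X_i)L(X_i)=\mu_j$ for $j=m+1,\ldots,l$. Problem $(\mathcal P_n')$: the same objective and moment constraints as $(\mathcal P_n)$, but with the real numbers $L(X_1),\ldots,L(X_n)$ as decision variables and with $L\in\mathcal L$ replaced by the stated discrete shape constraint. ''Equivalent'' / ''finite-dimensionally reducible'' means: the values at $X_1,\ldots,X_n$ of any $L\in\mathcal L$ satisfy the discrete shape constraint, and conversely any real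 numbers $L(X_1),\ldots,L(X_n)$ satisfying it are the values at $X_1,\ldots,X_n$ of some $L\in\mathcal L$; in particular $val(\mathcal P_n)=val(\mathcal P_n')$. Inequalities between vectors are component-wise and $[a,\infty)=\{x\in\mathbb R^d:x\ge a\}$. A function $f$ is orthounimodal about $a=(a_1,\ldots,a_d)$ if for each $i$ and any fixed $x_j$, $j\ne i$, the map $x_i\mapsto f(x)$ is non-decreasing on $(-\infty,a_i]$ and non-increasing on $[a_i,\infty)$; on $\mathcal X=[a,\infty)$ this means $f$ is non-increasing in each coordinate. $val(\cdot)$ is the optimal value in $[-\infty,\infty]$ ($\sup\emptyset=-\infty$). If $l=m$ the interior point condition is vacuous. $T^*$ is the minimal measurable majorant of a map $T:\Omega\to[-\infty,\infty]$ (measurable, $T^*\ge T$, and $T^*\le U$ a.s. for every measurable $U\ge T$ a.s.). $Z_n\overset{\text{a.s.*}}{\to}Z$ means $|Z_n-Z|^*\to0$ almost surely. *)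

(* Defs.v *)
From HB Require Import structures.
From mathcomp Require Import all_boot all_order all_algebra.
From mathcomp Require Import all_classical all_reals all_analysis.
From mathcomp Require Import measurable_realfun.

Set Implicit Arguments.
Unset Strict Implicit.
Unset Printing Implicit Defensive.

Import Order.TTheory GRing.Theory Num.Theory.
Import numFieldNormedType.Exports.

Local Open Scope classical_set_scope.
Local Open Scope ring_scope.

(* R^d is d.-tuple R with its product sigma-algebra. lebesgue_tuple d is Lebesgue
   measure on it, an iterated product; lebesgue_tuple_box characterizes it. *)
Section lebesgue_measure_tuple.
Context {R : realType}.
Local Open Scope ereal_scope.

Definition cons_pair n (p : measurableTypeR R * n.-tuple R) : n.+1.-tuple R :=
  [the n.+1.-tuple R of (p.1 : R) :: p.2].

Definition uncons n (x : n.+1.-tuple R) : measurableTypeR R * n.-tuple R :=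
  (thead x, [tuple of behead x]).

Lemma measurable_cons_pair n : measurable_fun [set: _] (@cons_pair n).
Proof.
have m1 : measurable_fun [set: measurableTypeR R * n.-tuple R]
    (fun p => p.1 : R).
  exact: (@measurable_fst _ _ (measurableTypeR R) (n.-tuple R)).
exact: (measurable_cons m1 measurable_snd).
Qed.

Lemma measurable_uncons n : measurable_fun [set: _] (@uncons n).
Proof.
apply/measurable_fun_pairP; split; last exact: measurable_behead.
exact: (@measurable_tnth _ R).
Qed.

Lemma cons_pairK n : cancel (@cons_pair n) (@uncons n).
Proof.
by case=> t u; rewrite /uncons /cons_pair /=; congr pair; apply/val_inj.
Qed.

Section lebesgue_cons.
Variables (n : nat) (mu : {sigma_finite_measure set (n.-tuple R) -> \bar R}).

Definition lebesgue_cons : set (n.+1.-tuple R) -> \bar R :=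
  pushforward (@lebesgue_measure R \x mu) (@cons_pair n).

Let lebesgue_cons0 : lebesgue_cons set0 = 0.
Proof. by rewrite /lebesgue_cons /pushforward preimage_set0 measure0. Qed.

Let lebesgue_cons_ge0 A : 0 <= lebesgue_cons A.
Proof. exact: (measure_ge0 (@lebesgue_measure R \x mu)). Qed.

Let lebesgue_cons_sigma_additive : semi_sigma_additive lebesgue_cons.
Proof.
move=> F mF tF mUF; rewrite /lebesgue_cons /pushforward preimage_bigcup.
have mc := @measurable_cons_pair n.
apply: measure_semi_sigma_additive.
- by move=> k; rewrite -[X in measurable X]setTI; exact: mc.
- apply/trivIsetP => /= i j _ _ ij; rewrite -preimage_setI.
  by move/trivIsetP : tF => /(_ _ _ _ _ ij) ->//; rewrite preimage_set0.
- by rewrite -preimage_bigcup -[X in measurable X]setTI; exact: mc.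
Qed.

HB.instance Definition _ := isMeasure.Build _ _ _ lebesgue_cons
  lebesgue_cons0 lebesgue_cons_ge0 lebesgue_cons_sigma_additive.

Let lebesgue_cons_sigma_finite : sigma_finite setT lebesgue_cons.
Proof.
have /sigma_finiteP[F [TF ndF Foo]] := sigma_finiteT (@lebesgue_measure R).
have /sigma_finiteP[G [TG ndG Goo]] := sigma_finiteT mu.
exists (fun k => @uncons n @^-1` (F k `*` G k)).
  apply/seteqP; split=> // x _.
  have [i _ Fi] : (\bigcup_k F k) (uncons x).1 by rewrite -TF.
  have [j _ Gj] : (\bigcup_k G k) (uncons x).2 by rewrite -TG.
  exists (maxn i j) => //; split.
  - by move: Fi; exact/subsetPset/ndF/leq_maxl.
  - by move: Gj; exact/subsetPset/ndG/leq_maxr.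
move=> k; have [mF Fk] := Foo k; have [mG Gk] := Goo k; split.
  by rewrite -[X in measurable X]setTI; apply: measurable_uncons => //;
    exact: measurableX.
rewrite /lebesgue_cons /pushforward -comp_preimage.
rewrite (_ : _ \o _ = id) ?preimage_id; last exact/funext/cons_pairK.
by rewrite product_measure1E// lte_mul_pinfty// ge0_fin_numE.
Qed.

HB.instance Definition _ := Measure_isSigmaFinite.Build _ _ _ lebesgue_cons
  lebesgue_cons_sigma_finite.

End lebesgue_cons.

Fixpoint lebesgue_tuple n : {sigma_finite_measure set (n.-tuple R) -> \bar R} :=
  match n with
  | 0%N => \d_([tuple] : 0.-tuple R)
  | k.+1 => lebesgue_cons (lebesgue_tuple k)
  end.

Lemma measurable_box n (B : 'I_n -> set R) : (forall i, measurable (B i)) ->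
  measurable [set x : n.-tuple R | forall i, B i (tnth x i)].
Proof.
move=> mB.
rewrite (_ : mkset _ = \bigcap_(i in [set: 'I_n]) ((@tnth n R ^~ i) @^-1` B i)).
  apply: fin_bigcap_measurable => // i _.
  have := @measurable_tnth _ R n i measurableT _ (mB i).
  by rewrite setTI.
by apply/seteqP; split => x /= h i; [move=> _|]; exact: h.
Qed.

Lemma lebesgue_tuple_box n (B : 'I_n -> set R) : (forall i, measurable (B i)) ->
  lebesgue_tuple n [set x | forall i, B i (tnth x i)] =
    \prod_(i < n) lebesgue_measure (B i).
Proof.
elim: n B => [|n IH] B mB.
  by rewrite big_ord0 /= diracE mem_set//; case.
rewrite big_ord_recl -IH//= /lebesgue_cons /pushforward.
have mB0 : measurable (B ord0 : set (measurableTypeR R)) by exact: mB.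
have mBS := @measurable_box _ (fun i => B (lift ord0 i)) (fun=> mB _).
rewrite -(product_measure1E _ _ mB0 mBS).
congr (product_measure1 _ _ _); apply/seteqP; split => -[t u] /=.
  move=> h; split => [|i]; first by have := h ord0.
  by have := h (lift ord0 i); rewrite tnthS.
by move=> [h0 h] i; case: (unliftP ord0 i) => [j ->|->] //; rewrite tnthS.
Qed.

End lebesgue_measure_tuple.

Section orthounimodality.
Context {R : realType} {d : nat}.
Implicit Types (a x y : d.-tuple R) (f : d.-tuple R -> R).

Definition le_vec x y : Prop := forall i, tnth x i <= tnth y i.

(* the set [a, +oo[ *)
Definition orthant a : set (d.-tuple R) := [set x | le_vec a x].

(* x and y range over the pairs of points of S that differ at most in the i-th
   coordinate. *)
Definition orthounimodal (S : set (d.-tuple R)) a f : Prop :=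
  forall i x y, S x -> S y ->
    (forall j, j != i -> tnth x j = tnth y j) ->
    (tnth x i <= tnth y i <= tnth a i -> f x <= f y) /\
    (tnth a i <= tnth x i <= tnth y i -> f y <= f x).

End orthounimodality.

Section problems.
Context {R : realType}.
Local Open Scope ereal_scope.

(* In the problems below mom 0 is the objective and mom j, for 0 < j <= l, is
   the left-hand side of the j-th moment constraint. *)
Definition feasible (l m : nat) (mu : nat -> R) (V : Type) (S : set V)
    (mom : nat -> V -> \bar R) : set V :=
  [set v | [/\ S v,
    forall j, (1 <= j <= m)%N -> mom j v <= (mu j)%:E &
    forall j, (m < j <= l)%N -> mom j v = (mu j)%:E]].

Definition optval (l m : nat) (mu : nat -> R) (V : Type) (S : set V)
    (mom : nat -> V -> \bar R) : \bar R :=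
  ereal_sup (mom 0%N @` feasible l m mu S mom).

Definition is_linear_program n (obj : ('I_n -> R) -> \bar R)
    (feas : set ('I_n -> R)) : Prop :=
  exists (c : 'I_n -> R) (K : finType) (A : K -> 'I_n -> R) (b : K -> R),
    (forall y, obj y = (\sum_i c i * y i)%R%:E) /\
    (forall y, feas y <-> forall k, (\sum_i A k i * y i <= b k)%R).

Definition finite_dim_reducible (T : Type) (S : set (T -> R)) n (x : 'I_n -> T)
    (D : set ('I_n -> R)) : Prop :=
  (forall L, S L -> D (fun i => L (x i))) /\
  (forall y, D y -> exists2 L, S L & forall i, L (x i) = y i).

End problems.

Section importance_weighting.
Context {R : realType} {d : nat}.
Variables (a : d.-tuple R) (g0 : d.-tuple R -> R).
Implicit Types (phi : nat -> d.-tuple R -> R) (M gamma : R).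

(* A real-valued g0 is finite at a. *)
Definition orthounimodal_density : Prop :=
  [/\ forall x, orthant a x -> 0 < g0 x,
      orthounimodal (orthant a) a g0,
      measurable_fun (orthant a) g0 &
      (\int[lebesgue_tuple d]_(x in orthant a) (g0 x)%:E = 1)%E].

Definition expect_g0 (h : d.-tuple R -> R) : \bar R :=
  (\int[lebesgue_tuple d]_(x in orthant a) (h x * g0 x)%:E)%E.

Definition norm_g0 (p : R) (h : d.-tuple R -> R) : \bar R :=
  (expect_g0 (fun x => (`|h x| `^ p)%R) `^ p^-1)%E.

(* No measurability is imposed: an orthounimodal function is Lebesgue but not
   necessarily Borel measurable, and since the integral of a nonnegative function
   is the supremum over the measurable simple functions below it, expect_g0 agrees
   with the integral for the completed measure on such functions. Values outside
   the orthant are irrelevant. *)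
Definition shape_class M gamma : set (d.-tuple R -> R) :=
  [set f | (forall x, orthant a x ->
              0 <= f x <= (M * g0 x) `^ (1 / (1 - gamma))) /\
           orthounimodal (orthant a) a f].

Definition likelihood_class M gamma : set (d.-tuple R -> R) :=
  [set (fun x => f x / g0 x) | f in shape_class M gamma].

Definition discrete_shape M gamma n (x : 'I_n -> d.-tuple R) :
    set ('I_n -> R) :=
  [set y | (forall i j, le_vec (x j) (x i) -> y i * g0 (x i) <= y j * g0 (x j)) /\
           (forall i, 0 <= y i * g0 (x i) <=
                      (M * g0 (x i)) `^ (1 / (1 - gamma)))].

Definition mom_P phi (j : nat) (L : d.-tuple R -> R) : \bar R :=
  expect_g0 (fun x => phi j x * L x).

Definition mom_Pn phi n (x : 'I_n -> d.-tuple R) (j : nat)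
    (L : d.-tuple R -> R) : \bar R :=
  (n%:R^-1 * \sum_i phi j (x i) * L (x i))%:E.

Definition mom_Pn' phi n (x : 'I_n -> d.-tuple R) (j : nat)
    (y : 'I_n -> R) : \bar R :=
  (n%:R^-1 * \sum_i phi j (x i) * y i)%:E.

Definition moment_set phi (l m : nat) M gamma : set 'rV[R]_(l - m) :=
  [set v | exists2 L, likelihood_class M gamma L &
     forall k : 'I_(l - m), mom_P phi (m + k.+1)%N L = (v ord0 k)%:E].

End importance_weighting.
Arguments moment_set {R d} a g0 phi l m M gamma.

Section sampling.
Context {dO : measure_display} {Omega : measurableType dO} {R : realType}.
Variable P : probability Omega R.

Definition mutually_independent {dT : measure_display} {T : measurableType dT}
    (X : nat -> {RV P >-> T}) : Prop :=
  forall (J : seq nat) (B : nat -> set T), uniq J ->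
    (forall i, measurable (B i)) ->
    P (\bigcap_(i in [set` J]) (X i @^-1` B i)) =
      (\prod_(i <- J) P (X i @^-1` B i))%E.

Definition iid_sample {d : nat} (a : d.-tuple R) (g0 : d.-tuple R -> R)
    (X : nat -> {RV P >-> d.-tuple R}) : Prop :=
  [/\ forall i w, orthant a (X i w),
      forall i B, measurable B -> distribution P (X i) B =
        (\int[lebesgue_tuple d]_(x in orthant a `&` B) (g0 x)%:E)%E &
      mutually_independent X].

Definition minimal_measurable_majorant (Z Zstar : Omega -> \bar R) : Prop :=
  [/\ measurable_fun [set: Omega] Zstar,
      forall w, (Z w <= Zstar w)%E &
      forall U : Omega -> \bar R, measurable_fun [set: Omega] U ->
        {ae P, forall w, (Z w <= U w)%E} ->
        {ae P, forall w, (Zstar w <= U w)%E}].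

(* Minimal measurable majorants are unique up to a.s. equality, so the choice of
   the sequence V is immaterial. *)
Definition as_star_cvg (Z : nat -> Omega -> \bar R) (z : \bar R) : Prop :=
  exists2 V : nat -> Omega -> \bar R,
    forall n, minimal_measurable_majorant (fun w => `|Z n w - z|%E) (V n) &
    {ae P, forall w, V ^~ w @ \oo --> 0%E}.

End sampling.

(* Main.v *)
Require Import Defs.
From HB Require Import structures.
From mathcomp Require Import all_boot all_order all_algebra.
From mathcomp Require Import all_classical all_reals all_analysis.
From mathcomp Require Import measurable_realfun.
From mathcomp Require Import ring lra zify.

Set Implicit Arguments.
Unset Strict Implicit.
Unset Printing Implicit Defensive.

Import Order.TTheory GRing.Theory Num.Theory.
Import numFieldNormedType.Exports.

Local Open Scope classical_set_scope.
Local Open Scope ring_scope.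

(** If [f] is nonincreasing in each coordinate and nonnegative on [[a, oo[], the
    values of [L = f / g0] at the sample points satisfy the discrete shape
    constraint, and conversely prescribed values [y i] are attained by the
    nonincreasing function [f z = max {y i * g0 (X i) | z <= X i}]; this is the
    reduction to a linear program.

    For the convergence of the optimal values, the core is a law of large
    numbers for [phi j (X i) * L (X i)], uniform in [L]. On a large cube where
    [phi j] is at most [c] and at most [c * g0], cut into [N ^ d] cells, a
    nonincreasing [f] lies between its values at the two extreme corners of each
    cell, and the sum of these oscillations is at most [O(N ^ (d - 1))] because
    it telescopes along diagonals. So finitely many averages (one per cell and
    one for the complement of the cube) control all [f] simultaneously. Each of
    them converges by a strong law for variables with a finite moment of order
    [1 + delta].

    Given uniform closeness of all moments, Slater's condition and the interior
    point condition yield members of the class with slack in the inequalities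
    and arbitrary right-hand sides of the equalities near [mu]; this property
    survives small perturbations of the moments (the equalities amount to a
    linear system close to a scalar one), and mixing a little of such a member
    into a nearly feasible one makes it feasible. Hence the values are close. *)

(** * Strong law of large numbers *)

(** Members of the class need not be measurable, which shapes the argument. The integral of a
    nonnegative function is used as a lower integral, which is monotone on all functions: an
    integral involving [f] is only squeezed between integrals of measurable weights, and linearity
    is applied to the weights alone. A uniform deviation bound is not known to be an event either,
    so eventual statements carry measurable events contained in it, and minimal majorants are
    compared with majorants built from these events.

    Monotonicity belongs to [f], not to [L = f / g0], so the division by [g0] is put into the
    weights. [L] itself is bounded, because [f <= (M * g0) ^ p] with [p = 1 / (1 - gamma) >= 1] and
    [g0] is largest at [a]; hence the part of [phi j] off a large region contributes at most a
    constant times its tail integral. The moment of order [1 + delta] gives deviation probabilities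
    of order [n ^ (- e)] with [e = min delta 1], which are summable along a polynomial
    subsequence. *)

Section law_of_large_numbers.
Context {dO dT : measure_display} {Omega : measurableType dO}
  {T : measurableType dT} {R : realType}.
Variables (P : probability Omega R) (X : nat -> {RV P >-> T}).

Definition identically_distributed := forall i A, measurable A ->
  P (X i @^-1` A) = P (X 0%N @^-1` A).

Definition pairwise_independent := forall i j A B, i != j ->
  measurable A -> measurable B ->
  P (X i @^-1` A `&` X j @^-1` B) = (P (X i @^-1` A) * P (X j @^-1` B))%E.

Hypothesis Xid : identically_distributed.
Hypothesis Xind : pairwise_independent.

Lemma ge0_integral_identically_distributed (f : T -> \bar R) i :
  measurable_fun setT f -> (forall x, (0 <= f x)%E) ->
  (\int[P]_w f (X i w) = \int[P]_w f (X 0%N w))%E.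
Proof.
move=> mf f0.
have H k : (\int[P]_w f (X k w) = \int[distribution P (X k)]_y f y)%E.
  by rewrite ge0_integral_distribution.
by rewrite !H; apply: eq_measure_integral => A mA _; exact: Xid.
Qed.

Lemma bounded_integrable (f : T -> R) (C : R) i : measurable_fun setT f ->
  (forall x, `|f x| <= C) -> P.-integrable setT (fun w => (f (X i w))%:E).
Proof.
move=> mf fC; apply: (@measurable_bounded_integrable _ _ _ _ (f \o X i)) => //.
- by rewrite (le_lt_trans (probability_le1 _ _))// ltry.
- exact: measurableT_comp.
- exists C; split; first exact: num_real.
  by move=> M CM w _ /=; rewrite (le_trans (fC _))// ltW.
Qed.

Lemma bounded_integral_identically_distributed (f : T -> R) (C : R) i :
  measurable_fun setT f -> (forall x, `|f x| <= C) ->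
  (\int[P]_w (f (X i w))%:E = \int[P]_w (f (X 0%N w))%:E)%E.
Proof.
move=> mf fC.
have H k : (\int[P]_w (f (X k w))%:E =
            \int[distribution P (X k)]_y (f y)%:E)%E.
  rewrite integral_distribution//; first exact/measurable_EFinP.
  exact: bounded_integrable fC.
by rewrite !H; apply: eq_measure_integral => A mA _; exact: Xid.
Qed.

(** By independence the law of the pair [W] agrees with the product of the marginal laws on
    rectangles, hence everywhere; Fubini then splits the integral. *)
Lemma integral_product_independent (f : T -> R) (C : R) i j : i != j ->
  measurable_fun setT f -> (forall x, `|f x| <= C) ->
  (\int[P]_w (f (X i w) * f (X j w))%:E =
   \int[P]_w (f (X i w))%:E * \int[P]_w (f (X j w))%:E)%E.
Proof.
move=> ij mf fC; pose W (w : Omega) : T * T := (X i w, X j w).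
have mW : measurable_fun setT W by exact/measurable_fun_pair.
pose g (p : T * T) : \bar R := (f p.1 * f p.2)%:E.
have mg : measurable_fun setT g.
  apply/measurable_EFinP; apply: measurable_funM.
    exact: measurableT_comp measurable_fst.
  exact: measurableT_comp measurable_snd.
have C0 : 0 <= C by apply: le_trans (fC (X 0%N point)).
have gC p : `|f p.1 * f p.2| <= C * C.
  by rewrite normrM ler_pM.
have ig : P.-integrable setT (g \o W).
  apply: (@measurable_bounded_integrable _ _ _ _
    (fun w => f (X i w) * f (X j w))) => //.
  - by rewrite (le_lt_trans (probability_le1 _ _))// ltry.
  - by apply: measurable_funM; exact: measurableT_comp.
  - exists (C * C); split; first exact: num_real.
    by move=> M CM w _ /=; rewrite (le_trans (gC (W w)))// ltW.
pose nu k := distribution P (X k).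
have ifk k : (nu k).-integrable setT (EFin \o f).
  apply: (@measurable_bounded_integrable _ _ _ _ f) => //.
  - by rewrite (le_lt_trans (probability_le1 _ _))// ltry.
  - exists C; split; first exact: num_real.
    by move=> M CM w _ /=; rewrite (le_trans (fC _))// ltW.
transitivity (\int[pushforward P W]_p g p)%E.
  by rewrite integral_pushforward//.
transitivity (\int[(nu i \x nu j)%E]_p g p)%E.
  apply: eq_measure_integral => A mA _; apply/esym.
  apply: (@product_measure_unique _ _ _ _ _ (nu i) (nu j)
    (pushforward P (HB.pack_for {mfun Omega >-> (T * T)%type} W
       (isMeasurableFun.Build _ _ _ _ W mW)))) => // B D mB mD.
  exact: Xind.
have igp : (nu i \x nu j)%E.-integrable setT g.
  apply: (@measurable_bounded_integrable _ _ _ _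
    (fun p => f p.1 * f p.2)) => //.
  - rewrite -setXTT /= product_measure1E//.
    have nu1 k : nu k setT = 1%E by exact: probability_setT.
    by rewrite [X in (X * _)%E]nu1 [X in (_ * X)%E]nu1 mule1 ltry.
  - exact/measurable_EFinP.
  - exists (C * C); split; first exact: num_real.
    by move=> M CM p _ /=; rewrite (le_trans (gC p))// ltW.
rewrite -integral12_prod_meas1// /fubini_F /g /=.
have H k : (\int[P]_w (f (X k w))%:E = \int[nu k]_y (f y)%:E)%E.
  rewrite integral_distribution//; first exact/measurable_EFinP.
  exact: bounded_integrable fC.
rewrite !H.
have [r2 Er2] : exists r, (\int[nu j]_y (f y)%:E = r%:E)%E.
  exists (fine (\int[nu j]_y (f y)%:E)%E).
  by rewrite fineK//; exact: integrable_fin_num (ifk j).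
under eq_integral.
  move=> x _.
  under eq_integral do rewrite EFinM.
  rewrite integralZl//; last exact: ifk.
  rewrite Er2; over.
rewrite Er2.
rewrite integralZr//; exact: ifk.
Qed.

End law_of_large_numbers.

Lemma measurable_gt_level d (T : measurableType d) (R : realType) (f : T -> R)
  (c : R) : measurable_fun setT f -> measurable [set x | c < f x].
Proof.
move=> mf; rewrite -[X in measurable X]setTI.
have mEf : measurable_fun setT (EFin \o f) by exact/measurable_EFinP.
exact: (emeasurable_fun_o_infty measurableT mEf c%:E).
Qed.

Section truncation.
Context {R : realType}.
Implicit Types h N delta : R.

(** The left side is nonzero only if [h > N], and then [h = h ^ (- delta) * h ^ (1 + delta)] with
    [h ^ (- delta) <= N ^ (- delta)]. *)
Lemma truncation_tail_le h N delta : 0 <= h -> 0 < N -> 0 < delta ->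
  h - Num.min h N <= N `^ (- delta) * h `^ (1 + delta).
Proof.
move=> h0 N0 d0; have [hN|Nh] := leP h N.
  by rewrite subrr mulr_ge0// powR_ge0.
have hp : 0 < h by exact: lt_trans Nh.
apply: (@le_trans _ _ h); first by rewrite lerBlDr lerDl ltW.
rewrite powRD ?(gt_eqF hp) ?implybT// powRr1// mulrCA ler_peMr//.
by rewrite powRN mulrC ler_pdivlMr ?powR_gt0// mul1r ge0_ler_powR// ?nnegrE ltW.
Qed.

(** Split the square into the powers [1 - delta] and [1 + delta], and bound the minimum by [N] in
    the first and by [h] in the second. The first exponent is nonnegative as [delta <= 1]. *)
Lemma truncation_square_le h N delta : 0 <= h -> 0 < N -> 0 < delta <= 1 ->
  Num.min h N ^+ 2 <= N `^ (1 - delta) * h `^ (1 + delta).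
Proof.
move=> h0 N0 /andP[d0 d1].
have [->|hn0] := eqVneq h 0.
  by rewrite (min_idPl (ltW N0)) expr0n/= mulr_ge0// powR_ge0.
have hp : 0 < h by rewrite lt_neqAle eq_sym hn0.
have tp : 0 < Num.min h N by rewrite lt_min hp.
have -> : Num.min h N ^+ 2 =
    Num.min h N `^ (1 - delta) * Num.min h N `^ (1 + delta).
  rewrite -powRD ?(gt_eqF tp) ?implybT// -powR_mulrn ?ltW//.
  by congr (_ `^ _); ring.
have tN : Num.min h N <= N by rewrite ge_min lexx orbT.
have th : Num.min h N <= h by rewrite ge_min lexx.
by apply: ler_pM; rewrite ?powR_ge0//; apply: ge0_ler_powR;
  rewrite ?nnegrE//; lra.
Qed.

End truncation.

Section law_of_large_numbers.
Context {dO dT : measure_display} {Omega : measurableType dO}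
  {T : measurableType dT} {R : realType}.
Variables (P : probability Omega R) (X : nat -> {RV P >-> T}).
Hypothesis Xid : identically_distributed X.
Hypothesis Xind : pairwise_independent X.

(** After expanding the square, each off-diagonal term is a product of two vanishing means. *)
Lemma integral_sum_square_centered (v : T -> R) (C : R) N :
  measurable_fun setT v -> (forall x, `|v x| <= C) ->
  (\int[P]_w (v (X 0%N w))%:E = 0)%E ->
  (\int[P]_w ((\sum_(i < N) v (X i w)) ^+ 2)%:E =
   N%:R%:E * \int[P]_w (v (X 0%N w) ^+ 2)%:E)%E.
Proof.
move=> mv vC Ev.
have C0 : 0 <= C by apply: le_trans (vC (X 0%N point)).
have imm i j : P.-integrable setT (fun w => (v (X i w) * v (X j w))%:E).
  apply: (@measurable_bounded_integrable _ _ _ _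
    (fun w => v (X i w) * v (X j w))) => //.
  - by rewrite (le_lt_trans (probability_le1 _ _))// ltry.
  - by apply: measurable_funM; exact: measurableT_comp.
  - exists (C * C); split; first exact: num_real.
    by move=> M CM w _ /=; rewrite (le_trans _ (ltW CM))// normrM ler_pM.
transitivity (\int[P]_w (\sum_(i < N) \sum_(j < N) (v (X i w) * v (X j w))%:E))%E.
  apply: eq_integral => w _; rewrite expr2 big_distrlr/=.
  by rewrite -sumEFin; apply: eq_bigr => i _; rewrite sumEFin.
rewrite integral_sum//; last by move=> i; exact: integrable_sum.
transitivity (\sum_(i < N) \int[P]_w (v (X 0%N w) ^+ 2)%:E)%E.
  apply: eq_bigr => i _; rewrite integral_sum// (bigD1 i)//= big1 ?adde0.
    under eq_integral do rewrite -expr2.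
    apply: (@ge0_integral_identically_distributed _ _ _ _ _ _ _ Xid
      (fun x => (v x ^+ 2)%:E)).
      by apply/measurable_EFinP; apply: measurable_funX.
    by move=> x; rewrite lee_fin sqr_ge0.
  move=> j ji; rewrite (integral_product_independent Xind _ mv vC) 1?eq_sym//.
  by rewrite (bounded_integral_identically_distributed Xid i mv vC) Ev mul0e.
have /fineK <- : (\int[P]_w (v (X 0%N w) ^+ 2)%:E)%E \is a fin_num.
  exact: integrable_fin_num (imm 0%N 0%N).
by rewrite sumEFin sumr_const card_ord -EFinM mulr_natl.
Qed.

(* Truncate [h] at [N]: Chebyshev's inequality handles the truncated average and
   Markov's inequality the remainder. *)
Lemma average_deviation_le (h : T -> R) (delta eta : R) :
  measurable_fun setT h -> (forall x, 0 <= h x) -> 0 < delta <= 1 ->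
  (\int[P]_w (h (X 0%N w) `^ (1 + delta))%:E < +oo)%E -> 0 < eta ->
  exists2 K : R, 0 <= K & forall N, (0 < N)%N ->
    (P [set w | (eta < `|N%:R^-1 * (\sum_(i < N) h (X i w)) -
                 fine (\int[P]_w (h (X 0%N w))%:E)%E|)%R]
     <= (K * N%:R `^ (- delta))%:E)%E.
Proof.
move=> mh h0 d01 hm eta0; have /andP[d0 d1] := d01.
set m1 := fine _.
pose m := fine (\int[P]_w (h (X 0%N w) `^ (1 + delta))%:E)%E.
have mhp : measurable_fun setT (fun x => h x `^ (1 + delta)).
  exact: measurableT_comp (measurable_powR _) mh.
have Em : (\int[P]_w (h (X 0%N w) `^ (1 + delta))%:E = m%:E)%E.
  rewrite /m fineK// ge0_fin_numE//; apply: integral_ge0 => w _.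
  by rewrite lee_fin powR_ge0.
have m0 : 0 <= m.
  by rewrite -lee_fin -Em; apply: integral_ge0 => w _; rewrite lee_fin powR_ge0.
(* The first term is Chebyshev's bound for a deviation [eta / 3] of the truncated average, the
   second Markov's bound for a remainder of average at least [eta / 3]. *)
exists (9 * m / eta ^+ 2 + 3 * m / eta).
  by rewrite addr_ge0// divr_ge0 ?mulr_ge0// ?exprn_ge0// ltW.
move=> N N0.
have Np : 0 < N%:R :> R by rewrite ltr0n.
have intc c : (\int[P]_w c%:E = c%:E)%E.
  by rewrite integral_cst// [X in (_ * X)%E](probability_setT P) mule1.
pose t x := Num.min (h x) N%:R.
pose r x := h x - t x.
have mt : measurable_fun setT t by exact: measurable_minr.
have mr : measurable_fun setT r by exact: measurable_funB.
have t0 x : 0 <= t x by rewrite le_min h0 ler0n.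
have r0 x : 0 <= r x by rewrite subr_ge0 ge_min lexx.
have tN x : `|t x| <= N%:R by rewrite ger0_norm// ge_min lexx orbT.
have itk i : P.-integrable setT (fun w => (t (X i w))%:E).
  exact: bounded_integrable tN.
pose et := fine (\int[P]_w (t (X 0%N w))%:E)%E.
have Eet : (\int[P]_w (t (X 0%N w))%:E = et%:E)%E.
  by rewrite /et fineK//; exact: integrable_fin_num (itk 0%N).
have rle x : r x <= N%:R `^ (- delta) * h x `^ (1 + delta).
  exact: truncation_tail_le.
have Er_le : (\int[P]_w (r (X 0%N w))%:E <= (N%:R `^ (- delta) * m)%:E)%E.
  apply: (@le_trans _ _ (\int[P]_w ((N%:R `^ (- delta))%:E *
                           (h (X 0%N w) `^ (1 + delta))%:E))%E).
    apply: ge0_le_integral => //.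
    - by move=> w _; rewrite lee_fin.
    - by apply/measurable_EFinP; exact: measurableT_comp.
    - apply/measurable_EFinP; apply: measurable_funM => //.
      exact: (measurableT_comp mhp).
    - by move=> w _; rewrite -EFinM lee_fin.
  rewrite ge0_integralZl_EFin ?powR_ge0//.
  - by rewrite Em.
  - by move=> w _; rewrite lee_fin powR_ge0.
  - by apply/measurable_EFinP; exact: (measurableT_comp mhp).
pose er := fine (\int[P]_w (r (X 0%N w))%:E)%E.
have Er0 : (0 <= \int[P]_w (r (X 0%N w))%:E)%E.
  by apply: integral_ge0 => w _; rewrite lee_fin.
have Eer : (\int[P]_w (r (X 0%N w))%:E = er%:E)%E.
  by rewrite /er fineK// ge0_fin_numE// (le_lt_trans Er_le)// ltry.
have er0 : 0 <= er by rewrite -lee_fin -Eer.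
have erle : er <= N%:R `^ (- delta) * m by rewrite -lee_fin -Eer.
have m1E : m1 = et + er.
  rewrite /m1; suff -> : (\int[P]_w (h (X 0%N w))%:E = (et + er)%:E)%E by [].
  rewrite EFinD -Eet -Eer -ge0_integralD//.
  - by apply: eq_integral => w _; rewrite -EFinD /r addrC subrK.
  - by move=> w _; rewrite lee_fin.
  - by apply/measurable_EFinP; exact: measurableT_comp.
  - by move=> w _; rewrite lee_fin.
  - by apply/measurable_EFinP; exact: measurableT_comp.
pose v x := t x - et.
have mv : measurable_fun setT v by exact: measurable_funB.
have vC x : `|v x| <= N%:R + `|et|.
  by rewrite (le_trans (ler_normB _ _))// lerD2r.
have Ev : (\int[P]_w (v (X 0%N w))%:E = 0)%E.
  under eq_integral do rewrite EFinB.
  rewrite integralB//; last exact: finite_measure_integrable_cst.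
  by rewrite Eet intc subee.
have Ev2 : (\int[P]_w (v (X 0%N w) ^+ 2)%:E <=
            (N%:R `^ (1 - delta) * m)%:E)%E.
  have it2 : P.-integrable setT (fun w => (t (X 0%N w) ^+ 2)%:E).
    apply: (@bounded_integrable _ _ _ _ _ _ _ (fun x => t x ^+ 2)
      (N%:R ^+ 2) 0%N).
      exact: measurable_funX.
    by move=> x; rewrite normrX lerXn2r// ?nnegrE ?ler0n.
  apply: (@le_trans _ _ (\int[P]_w (t (X 0%N w) ^+ 2)%:E)%E).
    rewrite (_ : \int[P]_w (v (X 0%N w) ^+ 2)%:E =
      \int[P]_w (t (X 0%N w) ^+ 2)%:E - (et ^+ 2)%:E)%E.
      by rewrite leeBlDr// leeDl// lee_fin sqr_ge0.
    transitivity (\int[P]_w ((t (X 0%N w) ^+ 2)%:E -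
      ((2 * et)%:E * (t (X 0%N w))%:E - (et ^+ 2)%:E)))%E.
      by apply: eq_integral => w _; rewrite -EFinM -!EFinB; congr EFin; rewrite /v; ring.
    have ic : P.-integrable setT (fun=> (et ^+ 2)%:E).
      exact: finite_measure_integrable_cst.
    rewrite integralB//; last by apply: integrableB => //; exact: integrableZl.
    rewrite integralB//; last exact: integrableZl.
    rewrite integralZl// Eet intc.
    congr (_ - _)%E; rewrite -EFinM -EFinB; congr EFin; ring.
  apply: (@le_trans _ _ (\int[P]_w ((N%:R `^ (1 - delta))%:E *
                           (h (X 0%N w) `^ (1 + delta))%:E))%E).
    apply: ge0_le_integral => //.
    - by move=> w _; rewrite lee_fin sqr_ge0.
    - exact: measurable_int it2.
    - apply/measurable_EFinP; apply: measurable_funM => //.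
      exact: (measurableT_comp mhp).
    - by move=> w _; rewrite -EFinM lee_fin truncation_square_le.
  rewrite ge0_integralZl_EFin ?powR_ge0//.
  - by rewrite Em.
  - by move=> w _; rewrite lee_fin powR_ge0.
  - by apply/measurable_EFinP; exact: (measurableT_comp mhp).
set A := [set w | _].
have msum (f : T -> R) : measurable_fun setT f ->
    measurable_fun setT (fun w => \sum_(i < N) f (X i w)).
  by move=> mf; apply: measurable_sum => i; exact: measurableT_comp.
have mA : measurable A.
  apply: measurable_gt_level.
  apply: measurableT_comp => //; apply: measurable_funB => //.
  by apply: measurable_funM => //; exact: msum.
(* If the bound on the mean [er] of the remainder exceeds [eta / 3], the second term alone makes the
   claimed bound at least 1. *)
have [big|small] := ltP (eta / 3) (N%:R `^ (- delta) * m).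
  apply: (le_trans (probability_le1 _ _)); first exact: mA.
  rewrite lee_fin mulrDl.
  apply: (@le_trans _ _ (3 * m / eta * N%:R `^ (- delta))).
    rewrite mulrAC ler_pdivlMr// mul1r.
    by move: big; rewrite ltr_pdivrMr// => /ltW; lra.
  by rewrite lerDr mulr_ge0 ?powR_ge0// divr_ge0 ?mulr_ge0 ?exprn_ge0 ?(ltW eta0).
pose S w := \sum_(i < N) v (X i w).
pose Q w := \sum_(i < N) r (X i w).
pose a := N%:R * (eta / 3).
have a0 : 0 < a by rewrite mulr_gt0// divr_gt0.
pose AS := [set w | (a ^+ 2)%:E <= `|(S w ^+ 2)%:E|]%E.
pose AQ := [set w | a%:E <= `|(Q w)%:E|]%E.
have mS : measurable_fun setT S by exact: msum.
have mQ : measurable_fun setT Q by exact: msum.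
have mS2 : measurable_fun setT (fun w => (S w ^+ 2)%:E).
  by apply/measurable_EFinP; apply: measurable_funX.
have mQe : measurable_fun setT (fun w => (Q w)%:E) by exact/measurable_EFinP.
have mAS : measurable AS.
  by rewrite -[AS]setTI; apply: emeasurable_fun_c_infty => //;
    exact: measurableT_comp.
have mAQ : measurable AQ.
  by rewrite -[AQ]setTI; apply: emeasurable_fun_c_infty => //;
    exact: measurableT_comp.
have Q0 w : 0 <= Q w by apply: sumr_ge0.
have sub : A `<=` AS `|` AQ.
  move=> w; rewrite /A /= => Aw.
  have [SA|SA] := leP a `|S w|.
    left; rewrite /AS /= lee_fin ger0_norm ?sqr_ge0// -[leRHS]real_normK ?num_real//.
    by rewrite lerXn2r// ?nnegrE ?ltW.
  right; rewrite /AQ /= lee_fin ger0_norm//.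
  rewrite leNgt; apply/negP => Qa; move: Aw; apply/negP; rewrite -leNgt.
  (* The average of [S] is below [eta / 3] in absolute value, and the average of [Q] and [er] both
     lie between 0 and [eta / 3]. *)
  have -> : N%:R^-1 * (\sum_(i < N) h (X i w)) - m1 =
      N%:R^-1 * S w + N%:R^-1 * Q w - er.
    rewrite m1E -mulrDr /S /Q -big_split/=.
    rewrite [in RHS](eq_bigr (fun i : 'I_N => h (X i w) - et)); last first.
      by move=> i _; rewrite /v /r; ring.
    rewrite big_split/= sumr_const card_ord -mulr_natr.
    by field; rewrite gt_eqF.
  have NS : `|N%:R^-1 * S w| < eta / 3.
    by rewrite normrM gtr0_norm ?invr_gt0// mulrC ltr_pdivrMr// mulrC.
  have NQ : N%:R^-1 * Q w < eta / 3 by rewrite mulrC ltr_pdivrMr// mulrC.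
  have NQ0 : 0 <= N%:R^-1 * Q w by rewrite mulr_ge0// invr_ge0 ltW.
  move: NS; rewrite ltr_norml => /andP[NS1 NS2].
  by rewrite ler_norml; apply/andP; split; lra.
apply: (le_trans (le_measure _ _ _ sub)); rewrite ?inE//.
  exact: measurableU.
apply: (le_trans (measureU2 _ _ _)) => //.
rewrite mulrDl EFinD; apply: leeD.
- have : ((a ^+ 2)%:E * P AS <= \int[P]_w `|(S w ^+ 2)%:E|)%E.
    have := @le_integral_comp_abse _ _ _ P setT measurableT
      (fun w => (S w ^+ 2)%:E) (a ^+ 2) id (@measurable_id _ _ _)
      (fun r r0 => r0) (fun x y _ _ xy => xy) mS2 (exprn_gt0 2 a0).
    by rewrite setTI.
  under eq_integral do rewrite gee0_abs ?lee_fin ?sqr_ge0//.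
  rewrite (integral_sum_square_centered _ mv vC Ev) => H.
  have : ((a ^+ 2)%:E * P AS <= N%:R%:E * (N%:R `^ (1 - delta) * m)%:E)%E.
    by apply: (le_trans H); apply: lee_wpmul2l => //; rewrite lee_fin.
  rewrite -lee_pdivlMl ?exprn_gt0// => /le_trans; apply.
  rewrite -!EFinM lee_fin le_eqVlt; apply/orP; left; apply/eqP.
  rewrite powRB ?(gt_eqF Np) ?implybT// powRr1 ?ltW// powRN.
  have : N%:R `^ delta != 0 :> R by rewrite gt_eqF// powR_gt0.
  have : eta != 0 by rewrite gt_eqF.
  have : N%:R != 0 :> R by rewrite gt_eqF.
  by rewrite /a => ? ? ?; field; apply/and3P.
- have : (a%:E * P AQ <= \int[P]_w `|(Q w)%:E|)%E.
    have := @le_integral_comp_abse _ _ _ P setT measurableT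
      (fun w => (Q w)%:E) a id (@measurable_id _ _ _)
      (fun r r0 => r0) (fun x y _ _ xy => xy) mQe a0.
    by rewrite setTI.
  under eq_integral do rewrite gee0_abs ?lee_fin ?Q0//.
  have -> : (\int[P]_w (Q w)%:E = N%:R%:E * er%:E)%E.
    under eq_integral do rewrite -sumEFin.
    rewrite ge0_integral_sum//.
    + transitivity (\sum_(i < N) \int[P]_w (r (X 0%N w))%:E)%E.
        apply: eq_bigr => i _.
        apply: (@ge0_integral_identically_distributed _ _ _ _ _ _ _ Xid
          (fun x => (r x)%:E)); first exact/measurable_EFinP.
        by move=> x; rewrite lee_fin.
      by rewrite Eer sumEFin sumr_const card_ord -EFinM mulr_natl.
    + by move=> i; apply/measurable_EFinP; exact: measurableT_comp.
    + by move=> i w _; rewrite lee_fin.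
  rewrite -lee_pdivlMl// => /le_trans; apply.
  rewrite -!EFinM lee_fin /a invfM.
  rewrite mulrACA mulVf ?gt_eqF// mul1r invf_div.
  apply: (@le_trans _ _ (3 / eta * (N%:R `^ (- delta) * m))).
    by rewrite ler_wpM2l// divr_ge0// ltW.
  by rewrite le_eqVlt; apply/orP; left; apply/eqP; ring.
Qed.

End law_of_large_numbers.

(** * From averages along a polynomial subsequence to all averages *)

Section polynomial_subsequence.
Context {R : realType}.

(** By convexity the power lies below its chord on the unit interval, which takes the values [1] and
    [2 ^+ p] at the ends. *)
Lemma powern_le_affine (x : R) p : 0 <= x <= 1 ->
  (1 + x) ^+ p <= 1 + (2 ^+ p - 1) * x.
Proof.
move=> /andP[x0 x1]; elim: p => [|p IH].
  by rewrite !expr0 subrr mul0r addr0.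
rewrite exprS; apply: (@le_trans _ _ ((1 + x) * (1 + (2 ^+ p - 1) * x))).
  by rewrite ler_wpM2l// addr_ge0.
rewrite exprS; set c := _ ^+ p.
have c1 : 1 <= c by rewrite exprn_ege1// ler1n.
have : (c - 1) * x * x <= (c - 1) * x.
  by rewrite ler_piMr// mulr_ge0// subr_ge0.
nra.
Qed.

(** Partial sums of nonnegative terms are monotone, so the sum up to [n] lies between the sums at
    two consecutive powers around [n], whose ratio is at most [1 + eta] for large [n]. The error is
    [(m + eta) * (1 + eta) - m]. *)
Lemma average_between_powers (a : nat -> R) (m eta : R) p k0 :
  (0 < p)%N -> (forall i, 0 <= a i) -> 0 <= m -> 0 < eta ->
  (forall k, (k0 <= k)%N ->
    `|(k.+1 ^ p)%:R^-1 * (\sum_(i < k.+1 ^ p) a i) - m| <= eta) ->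
  \forall n \near \oo,
    `|n%:R^-1 * (\sum_(i < n) a i) - m| <= eta * (1 + m + eta).
Proof.
move=> p0 a0 m0 eta0 H.
(* For [k >= k1] the chord bound gives a ratio of consecutive powers of at most
   [1 + 2 ^+ p / k.+1 <= 1 + eta]. *)
pose k1 := Num.truncn (2 ^+ p / eta).
pose K := maxn k0 k1.
near=> n.
have Kn : (K.+1 ^ p <= n)%N by near: n; exact: nbhs_infty_ge.
have n0 : (0 < n)%N by rewrite (leq_trans _ Kn)// expn_gt0.
pose Q k := (K <= k)%N && (k.+1 ^ p <= n)%N.
have exQ : exists k, Q k by exists K; rewrite /Q leqnn.
have ubQ k : Q k -> (k <= n)%N.
  case/andP => _ /(leq_trans _); apply; rewrite (@leq_trans k.+1)//.
  by rewrite -[X in (X <= _)%N]expn1 leq_pexp2l.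
have [k /andP[Kk kn] kmax] := ex_maxnP exQ ubQ.
have nk : (n <= k.+2 ^ p)%N.
  rewrite leqNgt; apply/negP => /ltnW kn'.
  have := kmax k.+1; rewrite /Q kn' andbT (leq_trans Kk)// => /(_ isT).
  by rewrite ltnn.
have k0k : (k0 <= k)%N by rewrite (leq_trans _ Kk)// leq_maxl.
have k1k : (k1 <= k)%N by rewrite (leq_trans _ Kk)// leq_maxr.
pose S n := \sum_(i < n) a i.
have Smono i j : (i <= j)%N -> S i <= S j.
  move=> ij; rewrite /S -!(big_mkord xpredT) (big_cat_nat (leq0n i) ij)/=.
  by rewrite lerDl sumr_ge0.
have S0 i : 0 <= S i by exact: sumr_ge0.
have ratio : (k.+2 ^ p)%:R <= (1 + eta) * (k.+1 ^ p)%:R :> R.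
  have kp : 0 < k.+1%:R :> R by rewrite ltr0n.
  have -> : (k.+2 ^ p)%:R = (1 + k.+1%:R^-1) ^+ p * (k.+1 ^ p)%:R :> R.
    rewrite !natrX -exprMn mulrDl mul1r mulVf ?gt_eqF//.
    by congr (_ ^+ _); rewrite -natr1.
  rewrite ler_wpM2r ?ler0n//; apply: (le_trans (powern_le_affine _ _)).
    by rewrite invr_ge0 ler0n invf_le1// ler1n.
  rewrite lerD2l; apply: (@le_trans _ _ (2 ^+ p * k.+1%:R^-1)).
    by rewrite ler_wpM2r ?invr_ge0// gerBl.
  rewrite ler_pdivrMr// mulrC -ler_pdivrMr// ltW//.
  apply: (lt_le_trans (truncnS_gt _)).
  by rewrite ler_nat ltnS.
have np : 0 < n%:R :> R by rewrite ltr0n.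
have up := H k.+1 (leqW k0k); have lo := H k k0k.
move: up lo; rewrite -/(S _) -/(S _) -/(S _) !ler_norml.
set A := (k.+1 ^ p)%:R in ratio *; set B := (k.+2 ^ p)%:R in ratio *.
have A0 : 0 < A by rewrite ltr0n expn_gt0.
have B0 : 0 < B by rewrite ltr0n expn_gt0.
have An : A <= n%:R by rewrite ler_nat.
have nB : n%:R <= B by rewrite ler_nat.
move=> /andP[_ up] /andP[lo _].
have {}up : S (k.+2 ^ p)%N <= (m + eta) * B.
  by rewrite -ler_pdivrMr// mulrC; lra.
have {}lo : (m - eta) * A <= S (k.+1 ^ p)%N.
  by rewrite -ler_pdivlMr// [leRHS]mulrC; lra.
have Sn1 := Smono _ _ kn; have Sn2 := Smono _ _ nk.
apply/andP; split; last first.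
  rewrite lerBlDr mulrC ler_pdivrMr//.
  apply: (le_trans Sn2); apply: (le_trans up).
  apply: (@le_trans _ _ ((m + eta) * ((1 + eta) * n%:R))).
    rewrite ler_wpM2l//; first by rewrite addr_ge0// ltW.
    by apply: (le_trans ratio); rewrite ler_wpM2l// addr_ge0// ltW.
  rewrite mulrA ler_wpM2r ?(ltW np)// le_eqVlt; apply/orP; left; apply/eqP.
  by ring.
rewrite lerBrDl [leRHS]mulrC ler_pdivlMr//.
have [me|me] := leP m eta.
  apply: le_trans (S0 n); rewrite mulr_le0_ge0 ?(ltW np)//.
  have : 0 <= eta * (m + eta) by rewrite mulr_ge0 ?addr_ge0// ltW.
  have -> : eta * (1 + m + eta) = eta + eta * (m + eta) by ring.
  by lra.
apply: le_trans Sn1; apply: le_trans lo.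
have An' : n%:R <= (1 + eta) * A by exact: le_trans ratio.
(* The factor [1 - eta] stands for the inverse of [1 + eta]: from [n <= (1 + eta) * A] follows
   [(1 - eta) * n <= A], as [(1 - eta) * (1 + eta) <= 1]. *)
apply: (@le_trans _ _ ((m - eta) * (1 - eta) * n%:R)).
  by rewrite ler_wpM2r ?(ltW np)//; nra.
rewrite -mulrA ler_wpM2l//; first by rewrite subr_ge0 ltW.
have [e1|e1] := leP 1 eta.
  by apply: (@le_trans _ _ 0); [rewrite mulr_le0_ge0 ?subr_le0 ?(ltW np)//|exact: ltW].
apply: (@le_trans _ _ ((1 - eta) * ((1 + eta) * A))).
  by rewrite ler_wpM2l// subr_ge0 ltW.
by rewrite mulrA ler_piMl ?(ltW A0)//; nra.
Unshelve. all: by end_near. Qed.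

(** The sharper bound [2 - n^-1] passes through the induction, since
    [(x + 1) ^- 2 <= x^-1 - (x + 1)^-1] telescopes. *)
Lemma sum_inverse_squares_le n : \sum_(0 <= k < n) (k.+1%:R ^- 2 : R) <= 2.
Proof.
case: n => [|n]; first by rewrite big_geq.
suff : \sum_(0 <= k < n.+1) (k.+1%:R ^- 2 : R) <= 2 - n.+1%:R^-1.
  by move/le_trans; apply; rewrite gerBl.
elim: n => [|n IH]; first by rewrite big_nat1 ?mulr1n expr1n !invr1; lra.
rewrite big_nat_recr//=; apply: (le_trans (lerD IH (lexx _))).
have n1 : 0 < n.+1%:R :> R by rewrite ltr0n.
have -> : n.+2%:R = n.+1%:R + 1 :> R by rewrite natr1.
set x := n.+1%:R in n1 *.
suff : (x + 1) ^- 2 <= x^-1 - (x + 1)^-1.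
  by move: (_ ^- 2) (x^-1) ((x + 1)^-1) => u v w; lra.
have -> : x^-1 - (x + 1)^-1 = (x * (x + 1))^-1.
  by field; apply/andP; split; rewrite gt_eqF//; lra.
rewrite lef_pV2 ?posrE; nra.
Qed.

End polynomial_subsequence.

(** The exceptional set is the limit superior of the [A k], which is null because the series of
    probabilities is bounded by [C]. *)
Lemma borel_cantelli_ae d (T : measurableType d) (R : realType)
    (P : probability T R) (A : nat -> set T) (C : R) :
  (forall k, measurable (A k)) ->
  (forall n, (\sum_(0 <= k < n) P (A k) <= C%:E)%E) ->
  {ae P, forall w, \forall k \near \oo, ~ A k w}.
Proof.
move=> mA HC.
have lt : (\sum_(k <oo) P (A k) < +oo)%E.
  apply: (@le_lt_trans _ _ C%:E); last exact: ltry.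
  apply: lime_le; first exact: is_cvg_nneseries.
  exact: nearW.
have P0 := lim_sup_set_cvg0 mA lt.
exists (lim_sup_set A); split => //.
  apply: bigcap_measurable => // n _; apply: bigcup_measurable => k _.
  exact: mA.
move=> w /= Hw n _; apply: contrapT => Hn; apply: Hw.
exists n => // k /= nk Ak; apply: Hn; by exists k.
Qed.

Section strong_law.
Context {dO dT : measure_display} {Omega : measurableType dO}
  {T : measurableType dT} {R : realType}.
Variables (P : probability Omega R) (X : nat -> {RV P >-> T}).
Hypothesis Xid : identically_distributed X.
Hypothesis Xind : pairwise_independent X.

Lemma strong_law (h : T -> R) (delta eps : R) :
  measurable_fun setT h -> (forall x, 0 <= h x) -> 0 < delta ->
  (\int[P]_w (h (X 0%N w) `^ (1 + delta))%:E < +oo)%E -> 0 < eps ->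
  {ae P, forall w, \forall n \near \oo,
    `|n%:R^-1 * (\sum_(i < n) h (X i w)) -
      fine (\int[P]_w (h (X 0%N w))%:E)%E| <= eps}.
Proof.
move=> mh h0 d0 hm eps0.
set m := fine _.
have m0 : 0 <= m by rewrite fine_ge0//; apply: integral_ge0 => w _; rewrite lee_fin.
(* The deviation bound requires an exponent at most 2; the moment of order [1 + e] stays finite
   because [x ^ (1 + e) <= 1 + x ^ (1 + delta)]. *)
pose e := Num.min delta 1.
have e0 : 0 < e by rewrite lt_min d0 ltr01.
have e1 : e <= 1 by rewrite ge_min lexx orbT.
have ed : e <= delta by rewrite ge_min lexx.
have hme : (\int[P]_w (h (X 0%N w) `^ (1 + e))%:E < +oo)%E.
  apply: (@le_lt_trans _ _
      (\int[P]_w (1%:E + (h (X 0%N w) `^ (1 + delta))%:E))%E).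
    apply: ge0_le_integral => //.
    - by move=> w _; rewrite lee_fin powR_ge0.
    - apply/measurable_EFinP.
      exact: (measurableT_comp (measurableT_comp (measurable_powR _) mh)).
    - apply/measurable_EFinP; apply: measurable_funD => //.
      exact: (measurableT_comp (measurableT_comp (measurable_powR _) mh)).
    - move=> w _; rewrite -EFinD lee_fin; set x := h _.
      have [x1|x1] := leP x 1.
        apply: (@le_trans _ _ 1); last by rewrite lerDl powR_ge0.
        apply: (@le_trans _ _ (1 `^ (1 + e))); last by rewrite powR1.
        by apply: ge0_ler_powR; rewrite ?nnegrE ?h0// addr_ge0// ltW.
      rewrite (@le_trans _ _ (x `^ (1 + delta)))//; last by rewrite lerDr.
      by apply: ler_powR; [exact: ltW|rewrite lerD2l].
  rewrite ge0_integralD//.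
  - by rewrite integral_cst// [X in (_ * X)%E](probability_setT P) mule1 lte_add_pinfty// ltry.
  - by move=> w _; rewrite lee_fin powR_ge0.
  - apply/measurable_EFinP.
    exact: (measurableT_comp (measurableT_comp (measurable_powR _) mh)).
(* Filling the gaps of the subsequence costs [eta * (1 + m + eta)], which is at most [eta * (2 + m)]
   as [eta <= 1]. *)
pose eta := Num.min 1 (eps / (2 + m)).
have eta0 : 0 < eta by rewrite lt_min ltr01 divr_gt0//; lra.
have etaeps : eta * (1 + m + eta) <= eps.
  have eta1 : eta <= 1 by rewrite ge_min lexx.
  have : eta <= eps / (2 + m) by rewrite ge_min lexx orbT.
  rewrite ler_pdivlMr; last by lra.
  apply: le_trans; apply: ler_wpM2l; [exact: ltW|lra].
have [|K K0 HK] := average_deviation_le Xid Xind mh h0 _ hme eta0.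
  by rewrite e0.
(* along [k ^ p] the deviation probabilities are [O(k ^ -2)] *)
pose p := (Num.truncn (2 / e)).+1.
have pe : 2 <= p%:R * e by rewrite -ler_pdivrMr// ltW// truncnS_gt.
pose A k := [set w | eta <
   `|(k.+1 ^ p)%:R^-1 * (\sum_(i < k.+1 ^ p) h (X i w)) - m|].
have mA k : measurable (A k).
  apply: measurable_gt_level; apply: measurableT_comp => //.
  apply: measurable_funB => //; apply: measurable_funM => //.
  by apply: measurable_sum => i; exact: measurableT_comp.
have PA n : (\sum_(0 <= k < n) P (A k) <= (K * 2)%:E)%E.
  apply: (@le_trans _ _ (\sum_(0 <= k < n) (K * k.+1%:R ^- 2)%:E)%E).
    apply: lee_sum => k _; apply: (le_trans (HK _ _)); first by rewrite expn_gt0.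
    rewrite lee_fin ler_wpM2l// natrX -powR_mulrn ?ler0n// -powRrM.
    rewrite -powR_invn ?ler0n// ler_powR ?ler1n//; lra.
  rewrite sumEFin lee_fin -mulr_sumr ler_wpM2l//.
  exact: sum_inverse_squares_le.
apply: filterS (borel_cantelli_ae mA PA) => w [k0 _ Hk0].
have Havg : \forall n \near \oo, `|n%:R^-1 * (\sum_(i < n) h (X i w)) - m| <=
    eta * (1 + m + eta).
  apply: (@average_between_powers _ (fun i => h (X i w)) m eta p k0) => //.
  by move=> k /Hk0 /negP; rewrite -leNgt.
by apply: filterS Havg => n Hn; exact: le_trans Hn etaeps.
Qed.

End strong_law.

(** * Minimal measurable majorants *)

Section minimal_majorant.
Context {dO : measure_display} {Omega : measurableType dO} {R : realType}.
Variable P : probability Omega R.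

Lemma measurable_contract : measurable_fun setT (@contract R).
Proof.
have -> : @contract R = fun x =>
    if x == +oo%E then 1 else if x == -oo%E then -1 else
      fine x / (1 + `|fine x|).
  by apply/funext => -[].
have meq (c : \bar R) : measurable_fun setT (fun x : \bar R => x == c).
  apply: (measurable_fun_bool true); rewrite setTI.
  rewrite (_ : _ @^-1` _ = [set c]); first exact: emeasurable_set1.
  by apply/seteqP; split => x /= /eqP.
apply: measurable_fun_ifT => //; apply: measurable_fun_ifT => //.
apply: (@measurableT_comp _ _ _ _ _ _ (fun r : R => r / (1 + `|r|))).
  apply: continuous_measurable_fun => r.
  apply: cvgM; first exact: cvg_id.
  apply: cvgV; first by rewrite gt_eqF// ltr_pwDl.
  by apply: cvgD; [exact: cvg_cst|exact: cvg_norm].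
exact: fine_measurable.
Qed.

Let cint (U : Omega -> \bar R) := \int[P]_w contract (U w).

Let contract_integrable (U : Omega -> \bar R) : measurable_fun setT U ->
  P.-integrable setT (fun w => (contract (U w))%:E).
Proof.
move=> mU.
apply: (@measurable_bounded_integrable _ _ _ _ (fun w => contract (U w))) => //.
- by rewrite (le_lt_trans (probability_le1 _ _))// ltry.
- exact: (measurableT_comp measurable_contract mU).
- exists 1; split; first exact: num_real.
  by move=> M M1 w _ /=; rewrite (le_trans (contract_le1 _))// ltW.
Qed.

(* The infimum of a sequence of measurable majorants minimizing the integral of
   their image under the bounded increasing map [contract]. *)
Lemma minimal_measurable_majorant_exists (Z : Omega -> \bar R) :
  exists V, minimal_measurable_majorant P Z V.
Proof.
pose A := [set U : Omega -> \bar R | measurable_fun setT U /\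
  forall w, (Z w <= U w)%E].
have cle U V : measurable_fun setT U -> measurable_fun setT V ->
    (forall w, (U w <= V w)%E) -> cint U <= cint V.
  move=> mU mV UV; apply: le_Rintegral => //; try exact: contract_integrable.
  by move=> w _; rewrite le_contract.
have Ay : A (fun=> +oo%E) by split => // w; exact: leey.
have inf_cA : has_inf [set cint U | U in A].
  split; first by exists (cint (fun=> +oo%E)), (fun=> +oo%E).
  exists (cint (fun=> -oo%E)) => _ [U [mU _] <-].
  by apply: cle => // w; exact: leNye.
set c := inf [set cint U | U in A].
have cP U : A U -> c <= cint U by move=> AU; apply: ge_inf; [exact: inf_cA.2|exists U].
have /choice[u uP] : forall k : nat, exists U, A U /\ cint U < c + k.+1%:R^-1.
  move=> k; have [|_ [U AU <-] HU] := @inf_adherent _ _ k.+1%:R^-1 _ inf_cA.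
    by rewrite invr_gt0 ltr0n.
  by exists U.
pose V w := einfs (u ^~ w) 0%N.
have mV : measurable_fun setT V.
  by apply: (measurable_fun_einfs (f := u)) => k; have [[]] := uP k.
have Vu k w : (V w <= u k w)%E by apply: ereal_inf_lbound; exists k.
have ZV w : (Z w <= V w)%E.
  by apply: le_ereal_inf_tmp => _ [k _ <-]; have [[_]] := uP k; exact.
have Vc : cint V <= c.
  apply/ler_addgt0Pl => e e0.
  have [k ke] : exists k, k.+1%:R^-1 < e.
    exists (Num.truncn e^-1); rewrite invf_plt ?posrE//.
    exact: truncnS_gt.
  have [[mu _] uc] := uP k.
  apply: (le_trans (cle _ _ mV mu (Vu k))); apply: (le_trans (ltW uc)).
  by rewrite addrC lerD2r ltW.
exists V; split => // U mU [N [mN N0 sub]].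
(* [U] dominates [Z] only off the null set [N]; the value [+oo] on [N] makes it a majorant
   everywhere, so that [W] below belongs to [A]. *)
pose U' w := if w \in N then +oo%E else U w.
have mU' : measurable_fun setT U'.
  apply: measurable_fun_ifT => //.
  apply: (measurable_fun_bool true); rewrite setTI.
  rewrite (_ : _ @^-1` _ = N)//.
  by apply/seteqP; split => w /=; [move/set_mem|move/mem_set].
pose W w := Order.min (V w) (U' w).
have mW : measurable_fun setT W by exact: measurable_mine.
have AW : A W.
  split => // w; rewrite le_min ZV/= /U'.
  case: ifPn => [_|]; first exact: leey.
  by rewrite notin_setE => wN; apply: contrapT => /= nle; apply: wN; exact: sub.
have WV w : (W w <= V w)%E by rewrite ge_min lexx.
(* [W] is a majorant below [V], and [V] attains the infimum [c]. The nonnegative difference of their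
   images then has integral 0, so it vanishes almost everywhere, and [contract] is injective. *)
have cWV : cint W = cint V.
  by apply/eqP; rewrite eq_le cle//= (le_trans Vc)// cP.
have iV := contract_integrable mV; have iW := contract_integrable mW.
have mVW : measurable_fun setT (fun w => (contract (V w) - contract (W w))%:E).
  by apply/measurable_EFinP; apply: measurable_funB;
    exact: (measurableT_comp measurable_contract).
have : (\int[P]_w `|(contract (V w) - contract (W w))%:E|)%E = 0%E.
  under eq_integral do rewrite gee0_abs ?lee_fin ?subr_ge0 ?le_contract//.
  rewrite integralB_EFin//.
  rewrite -[X in (X - _)%E]fineK; last exact: integrable_fin_num.
  rewrite -[X in (_ - X)%E]fineK; last exact: integrable_fin_num.
  by rewrite -EFinB; congr EFin; apply/eqP; rewrite subr_eq0; apply/eqP.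
move/(ae_eq_integral_abs _ measurableT mVW) => aeVW.
have aeN : {ae P, forall w, ~ N w}.
  by exists N; split => // w /= /contrapT.
apply: filterS2 aeVW aeN => w /(_ I) /= [/eqP] + nN.
rewrite subr_eq0 => /eqP /contract_inj ->.
by rewrite /W /U' memNset// ge_min lexx orbT.
Qed.

End minimal_majorant.

(** * Stability of optimal values under perturbation of the moments *)

Section convex_combinations.
Context {R : realType} {V : lmodType R}.
Variable S : set V.

Definition convex_closed := forall t u v, 0 <= t <= 1 -> S u -> S v ->
  S (t *: u + (1 - t) *: v).

Definition affine_on (F : V -> R) := forall t u v, 0 <= t <= 1 ->
  S u -> S v -> F (t *: u + (1 - t) *: v) = t * F u + (1 - t) * F v.

Hypothesis Sconv : convex_closed.

Lemma convex_combination n (w : 'I_n -> R) (u : 'I_n -> V) :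
  (forall k, 0 <= w k) -> \sum_k w k = 1 -> (forall k, S (u k)) ->
  S (\sum_k w k *: u k) /\
  forall F, affine_on F -> F (\sum_k w k *: u k) = \sum_k w k * F (u k).
Proof.
elim: n w u => [|n IH] w u w0 w1 Su.
  by move: w1; rewrite big_ord0 => /eqP; rewrite eq_sym oner_eq0.
have wE : \sum_(k < n) w (lift ord0 k) = 1 - w ord0.
  by rewrite -w1 big_ord_recl addrC addKr.
have wle : 0 <= 1 - w ord0 by rewrite -wE sumr_ge0.
have w01 : 0 <= w ord0 <= 1 by rewrite w0 -subr_ge0.
have [w1E|w1N] := eqVneq (w ord0) 1.
  have wk0 k : w (lift ord0 k) = 0.
    apply/eqP; move: wE; rewrite w1E subrr => /eqP.
    rewrite psumr_eq0// => /allP/(_ k); rewrite mem_index_enum => /(_ isT).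
    by [].
  split=> [|F _]; rewrite big_ord_recl w1E big1 ?addr0 ?scale1r ?mul1r//.
  - by move=> k _; rewrite wk0 scale0r.
  - rewrite big_ord_recl w1E mul1r big1 ?addr0// => k _.
    by rewrite wk0 mul0r.
  - by move=> k _; rewrite wk0 scale0r.
have t0 : 1 - w ord0 != 0 by rewrite subr_eq0 eq_sym.
pose w' k := w (lift ord0 k) / (1 - w ord0).
have [|||Sv Fv] := IH w' (fun k => u (lift ord0 k)).
- by move=> k; rewrite divr_ge0.
- by rewrite -mulr_suml wE divff.
- by move=> k; exact: Su.
have -> : \sum_k w k *: u k =
    w ord0 *: u ord0 + (1 - w ord0) *: \sum_k w' k *: u (lift ord0 k).
  rewrite big_ord_recl scaler_sumr; congr (_ + _); apply: eq_bigr => k _.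
  by rewrite scalerA /w' mulrCA divff// mulr1.
split=> [|F Fa]; first exact: Sconv.
rewrite Fa// Fv// big_ord_recl mulr_sumr; congr (_ + _).
by apply: eq_bigr => k _; rewrite mulrA /w' mulrCA divff// mulr1.
Qed.

End convex_combinations.

(** * Matrices close to a scalar matrix *)

Section near_scalar_matrix.
Context {R : realType} (q : nat).
Variables (A : 'M[R]_q) (rho e : R).
Hypothesis He : forall k i, `|A k i - rho *+ (k == i)| <= e.

Lemma near_scalar_mulmx_entry (v : 'rV[R]_q) i :
  `|rho * v 0 i - (v *m A) 0 i| <= e * \sum_k `|v 0 k|.
Proof.
have -> : rho * v 0 i - (v *m A) 0 i =
    - \sum_k v 0 k * (A k i - rho *+ (k == i)).
  under eq_bigr do rewrite mulrBr.
  rewrite big_split/= sumrN opprB mxE; congr (_ - _).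
  rewrite (bigD1 i)//= eqxx mulr1n big1 ?addr0 1?mulrC// => k ki.
  by rewrite (negbTE ki) mulr0n mulr0.
rewrite normrN (le_trans (ler_norm_sum _ _ _))// mulr_sumr ler_sum// => k _.
by rewrite normrM mulrC ler_wpM2r.
Qed.

Lemma near_scalar_mulmx_norm (v : 'rV[R]_q) : 0 <= rho ->
  (rho - q%:R * e) * \sum_k `|v 0 k| <= \sum_i `|(v *m A) 0 i|.
Proof.
move=> rho0; set s := \sum_k _; set b := \sum_i _.
have : \sum_i `|rho * v 0 i| <= \sum_i (`|(v *m A) 0 i| + e * s).
  apply: ler_sum => i _; rewrite -[X in `|X|](subrK ((v *m A) 0 i)) addrC.
  by rewrite (le_trans (ler_normD _ _))// lerD2l near_scalar_mulmx_entry.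
rewrite big_split/= [X in _ + X]sumr_const card_ord -[X in _ + X]mulr_natl.
rewrite [X in _ + X]mulrA.
under eq_bigr do rewrite normrM (ger0_norm rho0).
by rewrite -mulr_sumr -/s -/b mulrBl lerBlDr.
Qed.

(** A row vector [v] in the kernel satisfies [(rho - q * e) * |v| <= 0] in the sum norm, with a
    positive factor, so [v] is zero. *)
Lemma near_scalar_unitmx : 0 <= rho -> q%:R * e < rho -> A \in unitmx.
Proof.
move=> rho0 qe; rewrite -row_free_unit; apply: inj_row_free => v vA.
have := near_scalar_mulmx_norm v rho0; rewrite vA.
rewrite [leRHS]big1; last by move=> i _; rewrite mxE normr0.
rewrite pmulr_rle0 ?subr_gt0// => s0.
apply/rowP => i; rewrite mxE; apply/eqP; rewrite -normr_le0.
by apply: le_trans s0; rewrite (bigD1 i)//= lerDl sumr_ge0.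
Qed.

End near_scalar_matrix.

Section stability.
Context {R : realType} {V : lmodType R}.
Variables (S : set V) (l m : nat) (mu : nat -> R).
Hypotheses (hml : (m <= l)%N) (Sconv : convex_closed S).

(* The inequality constraints can be met with slack [rho] while the equality
   constraints take any right-hand side at distance at most [rho] from [mu]. *)
Definition robustly_feasible (F : nat -> V -> R) (rho : R) :=
  forall v : nat -> R, (forall j, (m < j <= l)%N -> `|v j - mu j| <= rho) ->
  exists L, [/\ S L, forall j, (1 <= j <= m)%N -> F j L <= mu j - rho &
    forall j, (m < j <= l)%N -> F j L = v j].

(** Mix into the Slater point [L0] a small proportion [th] of a member whose equality moments
    deviate from [mu] by [(v - mu) / th]: the mixture has equality moments [v], while the
    inequalities lose at most [th * (K + K1 + c) = c / 2] of their slack [c]. *)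
Lemma robustly_feasible_slater (F : nat -> V -> R) (K r : R) L0 :
  (forall j, affine_on S (F j)) ->
  (forall j L, (j <= l)%N -> S L -> `|F j L| <= K) -> S L0 ->
  (forall j, (1 <= j <= m)%N -> F j L0 < mu j) ->
  (forall j, (m < j <= l)%N -> F j L0 = mu j) -> 0 < r ->
  (forall v : nat -> R, (forall j, (m < j <= l)%N -> `|v j - mu j| <= r) ->
    exists2 L, S L & forall j, (m < j <= l)%N -> F j L = v j) ->
  exists2 rho, 0 < rho & robustly_feasible F rho.
Proof.
move=> Fa FK SL0 ineq0 eq0 r0 ball.
have [c c0 Hc] : exists2 c, 0 < c &
    forall j, (1 <= j <= m)%N -> F j L0 <= mu j - c.
  have : forall i, (i <= m)%N -> exists2 c, 0 < c &
      forall j, (1 <= j <= i)%N -> F j L0 <= mu j - c.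
    elim=> [|i IH] im.
      by exists 1 => // j /andP[/leq_trans H /H].
    have [c c0 Hc] := IH (ltnW im).
    have ci : 0 < mu i.+1 - F i.+1 L0 by rewrite subr_gt0 ineq0.
    exists (Num.min c (mu i.+1 - F i.+1 L0)); first by rewrite lt_min c0.
    move=> j /andP[j1]; rewrite leq_eqVlt => /orP[/eqP ->|ji].
      by rewrite lerBrDr -lerBrDl ge_min lexx orbT.
    rewrite (le_trans (Hc j _)) ?j1//.
    by rewrite lerD2l lerN2 ge_min lexx.
  by apply.
pose K1 := \sum_(j < l.+1) `|mu j|.
have muK1 j : (j <= l)%N -> `|mu j| <= K1.
  move=> jl; rewrite /K1 (bigD1 (Ordinal (jl : (j < l.+1)%N)))//=.
  by rewrite lerDl sumr_ge0.
have K0 : 0 <= K by apply: le_trans (FK 0%N L0 _ SL0).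
have K10 : 0 <= K1 by exact: sumr_ge0.
pose D := K + K1 + c.
have D0 : 0 < D by rewrite /D; lra.
pose th := c / (2 * D).
have th0 : 0 < th by rewrite divr_gt0// mulr_gt0.
have thD : th * D = c / 2 by rewrite /th; field; rewrite gt_eqF.
have th1 : th <= 1.
  by rewrite /th ler_pdivrMr ?mulr_gt0// mul1r /D; lra.
(* The bound [th * r] keeps the deviation [(v - mu) / th] within the radius [r]; [c / 2] is the
   remaining slack. *)
exists (Num.min (th * r) (c / 2)).
  by rewrite lt_min mulr_gt0//= divr_gt0.
move=> v Hv.
have [L1 SL1 HL1] : exists2 L, S L &
    forall j, (m < j <= l)%N -> F j L = mu j + (v j - mu j) / th.
  apply: ball => j /Hv; rewrite le_min => /andP[vr _].
  by rewrite addrC addKr normrM normfV (gtr0_norm th0) ler_pdivrMr// mulrC.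
have th01 : 0 <= th <= 1 by rewrite th1 ltW.
exists (th *: L1 + (1 - th) *: L0); split.
- exact: Sconv.
- move=> j j1m; rewrite Fa//.
  have jl : (j <= l)%N by case/andP: j1m => _ /leq_trans; apply.
  apply: (@le_trans _ _ (mu j - c / 2)); last first.
    by rewrite lerD2l lerN2 ge_min lexx orbT.
  have F1 : F j L1 <= K by exact: le_trans (ler_norm _) (FK _ _ jl SL1).
  have F0 := Hc j j1m.
  have mK : - mu j <= K1 by rewrite (le_trans _ (muK1 _ jl))// ler_normr lexx orbT.
  have : th * F j L1 <= th * K by rewrite ler_wpM2l// ltW.
  have : (1 - th) * F j L0 <= (1 - th) * (mu j - c).
    by rewrite ler_wpM2l// subr_ge0.
  have : th * (- mu j) <= th * K1 by rewrite ler_wpM2l// ltW.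
  move: thD; rewrite /D; set a := th * K; set b := th * K1.
  nra.
- move=> j jml; rewrite Fa// HL1// eq0//.
  by field; rewrite gt_eqF.
Qed.

(** [L1] has slack [rho] and equality deviations opposite to those of [L], scaled by [rho / Delta].
    The weight [t] on [L1] satisfies [t * rho = (1 - t) * Delta], so deviations cancel and slack
    offsets excess. The objective moves by at most [t * (2 * K)], and [t <= Delta / rho]. *)
Lemma robustly_feasible_mixing (F : nat -> V -> R) (K rho Delta : R) L :
  (forall j, affine_on S (F j)) -> (forall L, S L -> `|F 0%N L| <= K) ->
  0 < rho -> robustly_feasible F rho -> 0 < Delta -> S L ->
  (forall j, (1 <= j <= m)%N -> F j L <= mu j + Delta) ->
  (forall j, (m < j <= l)%N -> `|F j L - mu j| <= Delta) ->
  exists L', [/\ S L', forall j, (1 <= j <= m)%N -> F j L' <= mu j,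
    forall j, (m < j <= l)%N -> F j L' = mu j &
    F 0%N L - 2 * K * Delta / rho <= F 0%N L'].
Proof.
move=> Fa FK rho0 rob D0 SL Lineq Leq.
have [|L1 [SL1 L1ineq L1eq]] :=
    rob (fun j => mu j - rho / Delta * (F j L - mu j)).
  move=> j /Leq H; rewrite addrC addKr normrN normrM.
  rewrite gtr0_norm ?divr_gt0// mulrAC ler_pdivrMr//.
  by rewrite ler_wpM2l// ltW.
pose t := Delta / (Delta + rho).
have Dr : 0 < Delta + rho by exact: addr_gt0.
have t0 : 0 < t by exact: divr_gt0.
have t1 : t <= 1 by rewrite ler_pdivrMr// mul1r lerDl ltW.
have tE : t * (Delta + rho) = Delta by rewrite /t divfK ?gt_eqF.
have t01 : 0 <= t <= 1 by rewrite t1 ltW.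
exists (t *: L1 + (1 - t) *: L); split.
- exact: Sconv.
- move=> j j1m; rewrite Fa//.
  have : t * F j L1 <= t * (mu j - rho).
    by apply: ler_wpM2l; [exact: ltW|exact: L1ineq].
  have : (1 - t) * F j L <= (1 - t) * (mu j + Delta).
    by apply: ler_wpM2l; [rewrite subr_ge0|exact: Lineq].
  nra.
- move=> j jml; rewrite Fa// L1eq// /t.
  by field; rewrite !gt_eqF.
- rewrite Fa//.
  have := FK _ SL1; have := FK _ SL.
  rewrite !ler_norml => /andP[a1 a2] /andP[b1 b2].
  have tr : t * (2 * K) <= 2 * K * Delta / rho.
    rewrite mulrC -mulrA; apply: ler_wpM2l; first by lra.
    rewrite /t; apply: ler_wpM2l; first exact: ltW.
    by rewrite lef_pV2 ?posrE// lerDr ltW.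
  have : t * (F 0%N L - F 0%N L1) <= t * (2 * K).
    by apply: ler_wpM2l; [exact: ltW|lra].
  nra.
Qed.

(* The corners of a simplex around [v] are attained under [F]; under [F'] they
   move by at most [e], and the barycentric coordinates of [v] stay positive. *)
Lemma robustly_feasible_perturbation (F F' : nat -> V -> R) (e : R) :
  (forall j, affine_on S (F' j)) -> 0 < e ->
  robustly_feasible F (20 * (l - m).+1%:R * e) ->
  (forall j L, (j <= l)%N -> S L -> `|F' j L - F j L| <= e) ->
  robustly_feasible F' e.
Proof.
move=> Fa e0; set q := (l - m)%N; set rho := 20 * q.+1%:R * e => rob HF v Hv.
have q1 : q.+1%:R = q%:R + 1 :> R by rewrite natr1.
have q0 : 0 <= q%:R :> R by rewrite ler0n.
have rhoE : rho = 20 * (q%:R * e) + 20 * e by rewrite /rho q1; ring.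
have qe0 : 0 <= q%:R * e by rewrite mulr_ge0// ltW.
pose jj (k : 'I_q) := (m + k.+1)%N.
have jjP k : (m < jj k <= l)%N.
  rewrite /jj -[X in (X < _)%N]addn0 ltn_add2l ltn0Sn/=.
  by rewrite -(subnKC hml) leq_add2l.
have jjl k : (jj k <= l)%N by case/andP: (jjP k).
have jjS j : (m < j <= l)%N -> exists k, j = jj k.
  move=> /andP[mj jl].
  have kq : (j - m.+1 < q)%N by rewrite /q ltn_subLR//; lia.
  by exists (Ordinal kq); rewrite /jj /=; lia.
(* The base corner lies [10 * e] below [mu] in each coordinate. Since [v] and the moved corner shift
   by at most [e] each, the entries of [b] stay between [8 * e] and [12 * e]. *)
have [|L0 [SL0 L0ineq L0eq]] := rob (fun j => mu j - 10 * e).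
  by move=> j _; rewrite addrC addKr normrN gtr0_norm ?rhoE; lra.
have /choice[u uP] : forall k : 'I_q, exists L, [/\ S L,
    forall j, (1 <= j <= m)%N -> F j L <= mu j - rho &
    forall j, (m < j <= l)%N -> F j L = mu j - 10 * e + rho *+ (j == jj k)].
  move=> k; apply: rob => j _.
  by case: (j == jj k); rewrite ?mulr0n ?mulr1n ler_norml rhoE; lra.
pose w0 : 'rV[R]_q := \row_i F' (jj i) L0.
pose A : 'M[R]_q := \matrix_(k, i) (F' (jj i) (u k) - F' (jj i) L0).
pose b : 'rV[R]_q := \row_i (v (jj i) - F' (jj i) L0).
have bE i : `|b 0 i - 10 * e| <= 2 * e.
  rewrite mxE; have := Hv _ (jjP i); have := HF _ _ (jjl i) SL0.
  by rewrite L0eq// !ler_norml; lra.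
have AE k i : `|A k i - rho *+ (k == i)| <= 2 * e.
  have [Su _ ueq] := uP k.
  have := HF _ _ (jjl i) SL0; have := HF _ _ (jjl i) Su.
  rewrite mxE L0eq// ueq//.
  have -> : (jj i == jj k) = (k == i).
    by rewrite /jj eqn_add2l eqSS eq_sym.
  by move: (rho *+ _) => x; rewrite !ler_norml; lra.
have rho0 : 0 <= rho by rewrite rhoE; lra.
have uA : A \in unitmx.
  by apply: (near_scalar_unitmx AE) => //; rewrite rhoE; lra.
pose s : 'rV[R]_q := b *m invmx A.
have sA : s *m A = b by rewrite /s mulmxKV.
(* [rho] minus [q] times the entry error [2 * e] is [18 * q * e + 20 * e], while the entries of [b]
   sum to at most [12 * q * e]; the quotient is below [12 / 18]. *)
have s1 : \sum_k `|s 0 k| <= 2 / 3.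
  have := near_scalar_mulmx_norm AE s rho0; rewrite sA.
  set sg := \sum_k _; have sg0 : 0 <= sg by apply: sumr_ge0.
  have : \sum_i `|b 0 i| <= \sum_(i < q) 12 * e.
    by apply: ler_sum => i _; have := bE i; rewrite !ler_norml; lra.
  rewrite sumr_const card_ord -mulr_natl => bs /le_trans /(_ bs) H.
  have {H bs} : (18 * (q%:R * e) + 20 * e) * sg <= 12 * (q%:R * e).
    by move: H; rewrite rhoE; lra.
  set x := q%:R * e in qe0 *; move=> H.
  have x0 : 0 < 18 * x + 20 * e by lra.
  rewrite leNgt; apply/negP => sg23.
  have : (18 * x + 20 * e) * (2 / 3) < (18 * x + 20 * e) * sg by rewrite ltr_pM2l.
  by lra.
(* [rho * s 0 i] differs from [b 0 i >= 8 * e] by at most [2 * e * (2 / 3)]. *)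
have s0 i : 0 <= s 0 i.
  have := near_scalar_mulmx_entry AE s i; rewrite sA => H.
  have : 2 * e * \sum_k `|s 0 k| <= 2 * e * (2 / 3) by rewrite ler_wpM2l//; lra.
  move: H (bE i); rewrite !ler_norml => /andP[H1 H2] /andP[B1 B2] H3.
  have rp : 0 < rho by rewrite rhoE; lra.
  by rewrite -(pmulr_rge0 _ rp); lra.
have ss1 : \sum_k s 0 k <= 1.
  apply: (@le_trans _ _ (2 / 3)); last by lra.
  by apply: le_trans s1; apply: ler_sum => k _; exact: ler_norm.
(* Index [ord0] stands for the base corner [L0], which takes the remaining weight
   [1 - \sum_k s 0 k]. *)
pose w (k : 'I_q.+1) := if unlift ord0 k is Some k' then s 0 k'
  else 1 - \sum_k s 0 k.
pose U (k : 'I_q.+1) := if unlift ord0 k is Some k' then u k' else L0.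
have w_lift k : w (lift ord0 k) = s 0 k by rewrite /w liftK.
have w_0 : w ord0 = 1 - \sum_k s 0 k by rewrite /w unlift_none.
have U_lift k : U (lift ord0 k) = u k by rewrite /U liftK.
have U_0 : U ord0 = L0 by rewrite /U unlift_none.
have w1 : \sum_k w k = 1.
  by rewrite big_ord_recl w_0 (eq_bigr _ (fun k _ => w_lift k)) subrK.
have wge0 k : 0 <= w k.
  by rewrite /w; case: unliftP => [k' _|_]; [exact: s0|rewrite subr_ge0].
have SU k : S (U k).
  by rewrite /U; case: unliftP => [k' _|_] //; have [] := uP k'.
have [SL HL] := convex_combination Sconv wge0 w1 SU.
exists (\sum_k w k *: U k); split=> // [j j1m|j jml].
- rewrite HL//; have jl : (j <= l)%N by case/andP: j1m => _ /leq_trans; apply.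
  have -> : mu j - e = \sum_k w k * (mu j - e) by rewrite -mulr_suml w1 mul1r.
  apply: ler_sum => k _; apply: ler_wpM2l => //.
  have : F j (U k) <= mu j - rho.
    rewrite /U; case: unliftP => [k' _|_]; last exact: L0ineq.
    by have [_ + _] := uP k'; apply.
  have := HF _ _ jl (SU k); rewrite ler_norml rhoE; lra.
- rewrite HL//; have [i ->] := jjS _ jml.
  rewrite big_ord_recl w_0 U_0.
  rewrite [X in _ + X](eq_bigr (fun k => s 0 k * F' (jj i) (u k))); last first.
    by move=> k _; rewrite w_lift U_lift.
  have : (s *m A) 0 i = b 0 i by rewrite sA.
  rewrite !mxE => H.
  have : \sum_k s 0 k * F' (jj i) (u k) =
      v (jj i) - F' (jj i) L0 + (\sum_k s 0 k) * F' (jj i) L0.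
    rewrite -H mulr_suml -big_split/=; apply: eq_bigr => k _.
    by rewrite !mxE; ring.
  by move=> ->; ring.
Qed.

(** A feasible member for [mom] violates the constraints of [mom'] by at most [Delta]; mixing
    repairs this at the cost [2 * K * Delta / rho], and the change of objective adds [Delta]. *)
Lemma optval_le_perturbation (F F' : nat -> V -> R)
    (mom mom' : nat -> V -> \bar R) (K rho Delta : R) :
  (forall j L, (j <= l)%N -> S L -> mom j L = (F j L)%:E) ->
  (forall j L, (j <= l)%N -> S L -> mom' j L = (F' j L)%:E) ->
  (forall j, affine_on S (F' j)) -> (forall L, S L -> `|F' 0%N L| <= K) ->
  0 < rho -> robustly_feasible F' rho -> 0 < Delta ->
  (forall j L, (j <= l)%N -> S L -> `|F' j L - F j L| <= Delta) ->
  (optval l m mu S mom <=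
   optval l m mu S mom' + (Delta + 2 * K * Delta / rho)%:E)%E.
Proof.
move=> hm hm' Fa FK rho0 rob D0 HF.
apply: ge_ereal_sup => _ [L [SL Lineq Leq] <-]; rewrite hm//.
have [||L' [SL' L'ineq L'eq L'0]] :=
    robustly_feasible_mixing (L := L) Fa FK rho0 rob D0 SL.
- move=> j j1m; have jl : (j <= l)%N by case/andP: j1m => _ /leq_trans; apply.
  have := Lineq j j1m; rewrite hm// lee_fin.
  by have := HF _ _ jl SL; rewrite ler_norml; lra.
- move=> j jml; have jl : (j <= l)%N by case/andP: jml.
  have := Leq j jml; rewrite hm// => -[<-]; exact: HF.
have : ((F' 0%N L')%:E <= optval l m mu S mom')%E.
  apply: ereal_sup_ubound; exists L'; last by rewrite hm'.
  split=> // j jm.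
    rewrite hm' ?lee_fin ?L'ineq//.
    by case/andP: jm => _ /leq_trans; apply.
  by rewrite hm' ?L'eq//; case/andP: jm.
move/(leeD2r (Delta + 2 * K * Delta / rho)%:E); apply: le_trans.
rewrite -EFinD lee_fin; have := HF _ _ (leq0n l) SL; rewrite ler_norml.
move: L'0; set x := _ / rho; lra.
Qed.

(** The one-sided comparison is used in both directions, with margin [rho] for [F] and the inherited
    margin [e] for [F'], so that [Delta] does not depend on [F']. *)
Lemma optval_stable (F : nat -> V -> R) (mom : nat -> V -> \bar R)
    (K rho eta : R) :
  (forall j L, (j <= l)%N -> S L -> mom j L = (F j L)%:E) ->
  (forall j, affine_on S (F j)) ->
  (forall j L, (j <= l)%N -> S L -> `|F j L| <= K) ->
  0 < rho -> robustly_feasible F rho -> 0 < eta ->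
  exists2 Delta, 0 < Delta & forall F' mom',
    (forall j L, (j <= l)%N -> S L -> mom' j L = (F' j L)%:E) ->
    (forall j, affine_on S (F' j)) ->
    (forall j L, (j <= l)%N -> S L -> `|F' j L - F j L| <= Delta) ->
    (`|optval l m mu S mom' - optval l m mu S mom| <= eta%:E)%E.
Proof.
move=> hm Fa FK rho0 rob eta0.
(* The right-hand side [mu] itself gives a feasible point of the unperturbed problem, which bounds
   its value below by [- K]. *)
have [L0 [SL0 L0ineq L0eq]] := rob mu (fun j _ => eq_ind_r (fun x => `|x| <= rho)
  (eq_ind_r (fun x => x <= rho) (ltW rho0) (normr0 _)) (subrr (mu j))).
have K0 : 0 <= K by apply: le_trans (FK 0%N L0 _ SL0).
pose e := rho / (20 * (l - m).+1%:R).
have q0 : 0 < 20 * (l - m).+1%:R :> R by rewrite mulr_gt0 ?ltr0n.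
have e0 : 0 < e by exact: divr_gt0.
have rhoE : rho = 20 * (l - m).+1%:R * e by rewrite /e mulrC divfK ?gt_eqF.
(* [C] dominates the factor of [Delta] in both comparisons; [K + 1] bounds the perturbed objective
   because [Delta <= 1]. *)
pose C := 1 + 2 * (K + 1) / e + 2 * K / rho.
have t1 : 0 <= 2 * (K + 1) / e by rewrite divr_ge0 ?(ltW e0)//; lra.
have t2 : 0 <= 2 * K / rho by rewrite divr_ge0 ?(ltW rho0)//; lra.
have C0 : 0 < C by rewrite /C; lra.
pose Delta := Num.min (Num.min e 1) (eta / C).
have D0 : 0 < Delta by rewrite !lt_min e0 ltr01/= divr_gt0.
have De : Delta <= e by rewrite !ge_min lexx.
have D1 : Delta <= 1 by rewrite !ge_min lexx orbT.
have DC : Delta * C <= eta by rewrite -ler_pdivlMr// ge_min lexx orbT.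
exists Delta => // F' mom' hm' Fa' HF.
have rob' : robustly_feasible F' e.
  apply: (robustly_feasible_perturbation (F := F) Fa' e0); first by rewrite -rhoE.
  by move=> j L jl SL; exact: le_trans (HF j L jl SL) De.
have FK' L : S L -> `|F' 0%N L| <= K + 1.
  move=> SL; rewrite -[X in `|X|](subrK (F 0%N L)) addrC.
  rewrite (le_trans (ler_normD _ _))// lerD ?FK//.
  exact: le_trans (HF 0%N L (leq0n _) SL) D1.
have le1 := optval_le_perturbation hm hm' Fa' FK' e0 rob' D0 HF.
have HF2 j L : (j <= l)%N -> S L -> `|F j L - F' j L| <= Delta.
  by move=> jl SL; rewrite distrC HF.
have le2 := optval_le_perturbation hm' hm Fa (fun L => FK 0%N L (leq0n _)) rho0
  rob D0 HF2.
have {}le1 : (optval l m mu S mom <= optval l m mu S mom' + eta%:E)%E.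
  apply: (le_trans le1); rewrite leeD2l// lee_fin; apply: le_trans DC.
  have -> : Delta + 2 * (K + 1) * Delta / e = Delta * (1 + 2 * (K + 1) / e).
    by ring.
  by apply: ler_wpM2l; [exact: ltW|rewrite /C; lra].
have {}le2 : (optval l m mu S mom' <= optval l m mu S mom + eta%:E)%E.
  apply: (le_trans le2); rewrite leeD2l// lee_fin; apply: le_trans DC.
  have -> : Delta + 2 * K * Delta / rho = Delta * (1 + 2 * K / rho) by ring.
  by apply: ler_wpM2l; [exact: ltW|rewrite /C; lra].
have lb : ((- K)%:E <= optval l m mu S mom)%E.
  apply: (@le_trans _ _ (F 0%N L0)%:E).
    by rewrite lee_fin; have := FK 0%N L0 (leq0n _) SL0; rewrite ler_norml => /andP[].
  apply: ereal_sup_ubound; exists L0; last by rewrite hm.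
  split=> // j jm.
    rewrite hm//; first by rewrite lee_fin (le_trans (L0ineq j jm))// gerBl ltW.
    by case/andP: jm => _ /leq_trans; apply.
  by rewrite hm ?L0eq//; case/andP: jm.
have ub : (optval l m mu S mom <= K%:E)%E.
  apply: ge_ereal_sup => _ [L [SL _ _] <-]; rewrite hm// lee_fin.
  exact: le_trans (ler_norm _) (FK 0%N L (leq0n _) SL).
move: lb ub le1 le2; case: (optval l m mu S mom) => [x| |]//= _ _.
case: (optval l m mu S mom') => [y| |]//=; rewrite ?lee_fin => h1 h2.
by rewrite ler_norml; lra.
Qed.

End stability.

(** * Monotone functions on a grid *)

Section orthant.
Context {R : realType} {d : nat}.
Implicit Types (a x y : d.-tuple R) (f : d.-tuple R -> R).

Lemma le_vec_refl x : le_vec x x. Proof. by []. Qed.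

Lemma le_vec_trans y x z : le_vec x y -> le_vec y z -> le_vec x z.
Proof. by move=> xy yz i; exact: le_trans (xy i) (yz i). Qed.

Definition nonincreasing_on_orthant a f := forall x y, orthant a x ->
  orthant a y -> le_vec x y -> f y <= f x.

(** Orthounimodality compares points differing in one coordinate, so pass from [x] to [y] through
    the points [h k], which have the first [k] coordinates of [y] and the others of [x]. *)
Lemma orthounimodal_nonincreasing a f : orthounimodal (orthant a) a f ->
  nonincreasing_on_orthant a f.
Proof.
move=> fo x y ax ay xy.
pose h (k : nat) := [tuple if (i < k)%N then tnth y i else tnth x i | i < d].
have ah k : orthant a (h k).
  by move=> i; rewrite tnth_mktuple; case: ifP => _; [exact: ay|exact: ax].
have hle k : (k <= d)%N -> f (h k) <= f (h 0%N).
  elim: k => // k IH kd; apply: le_trans (IH (ltnW kd)).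
  have hj j : j != Ordinal kd -> tnth (h k) j = tnth (h k.+1) j.
    by rewrite -val_eqE/= !tnth_mktuple ltnS (leq_eqVlt j k) => /negbTE ->.
  have [_] := fo (Ordinal kd) (h k) (h k.+1) (ah _) (ah _) hj.
  by apply; rewrite !tnth_mktuple /= ltnn ltnSn ax xy.
have -> : x = h 0%N by apply: eq_from_tnth => i; rewrite tnth_mktuple.
rewrite [y](_ : _ = h d) ?hle//.
by apply: eq_from_tnth => i; rewrite tnth_mktuple ltn_ord.
Qed.

(** In the orthant the increasing branch is degenerate: [tnth y i <= tnth a i] forces [x = y]. *)
Lemma nonincreasing_orthounimodal a f : nonincreasing_on_orthant a f ->
  orthounimodal (orthant a) a f.
Proof.
move=> fd i x y ax ay xy; split=> [/andP[xiy yia]|/andP[_ xiy]].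
  suff -> : x = y by [].
  apply: eq_from_tnth => j; have [->|ji] := eqVneq j i; last exact: xy.
  by apply/eqP; rewrite eq_le xiy (le_trans yia (ax i)).
apply: fd => // j; have [->|ji] := eqVneq j i; first exact: xiy.
by rewrite xy.
Qed.

Lemma measurable_orthant a : measurable (orthant a).
Proof.
have mB (i : 'I_d) : measurable [set` `[tnth a i, +oo[] by exact: measurable_itv.
rewrite (_ : orthant a = [set x | forall i, [set` `[tnth a i, +oo[] (tnth x i)]).
  exact: measurable_box mB.
by apply/seteqP; split=> x ax i; have := ax i; rewrite /= in_itv/= andbT.
Qed.

End orthant.

(* Unlike [ge0_le_integral], without measurability of [f] and [g]. *)
Lemma ge0_le_lower_integral d (T : measurableType d) (R : realType)
    (mu : {measure set T -> \bar R}) (D : set T) (f g : T -> \bar R) :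
  (forall x, D x -> (0 <= f x)%E) -> (forall x, D x -> (f x <= g x)%E) ->
  (\int[mu]_(x in D) f x <= \int[mu]_(x in D) g x)%E.
Proof.
move=> f0 fg.
have g0 x : D x -> (0 <= g x)%E by move=> Dx; exact: le_trans (f0 _ Dx) (fg _ Dx).
rewrite !ge0_integralE//; apply: ge_ereal_sup => _ [h hf <-].
apply: ereal_sup_ubound; exists h => // x.
apply: (le_trans (hf x)); rewrite !patchE.
by case: ifPn => // /set_mem; exact: fg.
Qed.

(** The indicator is a product over coordinates with trivial factors except at [i], so the sum
    distributes. The factor [N] on the left avoids the exponent [d - 1]. *)
Lemma card_ffun_fixed_coordinate (R : realType) (d N : nat) (i : 'I_d)
    (j : 'I_N) :
  N%:R * \sum_(k : {ffun 'I_d -> 'I_N}) (k i == j)%:R = N%:R ^+ d :> R.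
Proof.
pose F (i' : 'I_d) (j' : 'I_N) : R := if i' == i then (j' == j)%:R else 1.
have -> : \sum_(k : {ffun 'I_d -> 'I_N}) (k i == j)%:R =
    \sum_(k : {ffun 'I_d -> 'I_N}) \prod_i' F i' (k i').
  apply: eq_bigr => k _; rewrite (bigD1 i)//= /F eqxx big1 ?mulr1//.
  by move=> i' /negbTE ->.
rewrite -bigA_distr_bigA/= (bigD1 i)//= {1}/F eqxx.
rewrite (bigD1 j)//= eqxx big1 ?addr0 ?mul1r; last first.
  by move=> j' /negbTE ->.
rewrite -[in RHS](card_ord d) -prodr_const [in RHS](bigD1 i)//=.
congr (_ * _); apply: eq_bigr => i' /negbTE i'i.
by rewrite /F i'i sumr_const card_ord.
Qed.

Section grid.
Context {R : realType} {d : nat}.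
Variables (a : d.-tuple R) (h : R) (N : nat).
Hypothesis h0 : 0 < h.

(** Indices are natural numbers because the upper corner of a cell may have index [N]. *)
Definition grid_point (k : 'I_d -> nat) : d.-tuple R :=
  [tuple tnth a i + h * (k i)%:R | i < d].

(** Half-open, so that distinct cells are disjoint. *)
Definition grid_cube (k : {ffun 'I_d -> 'I_N}) : set (d.-tuple R) :=
  [set x | forall i, tnth x i \in
    `[tnth a i + h * (k i)%:R, tnth a i + h * (k i).+1%:R[].

Lemma orthant_grid_point k : orthant a (grid_point k).
Proof. by move=> i; rewrite tnth_mktuple lerDl mulr_ge0 ?ler0n// ltW. Qed.

Lemma grid_cube_le k x : grid_cube k x ->
  le_vec (grid_point (fun i => k i)) x /\
  le_vec x (grid_point (fun i => (k i).+1)).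
Proof.
move=> kx; split => i; rewrite tnth_mktuple; have := kx i; rewrite in_itv/=.
  by case/andP.
by case/andP => _ /ltW.
Qed.

Lemma grid_cube_orthant k x : grid_cube k x -> orthant a x.
Proof.
by move=> /grid_cube_le[+ _]; apply: le_vec_trans; exact: orthant_grid_point.
Qed.

Lemma grid_cube_cover x : orthant a x ->
  (forall i, tnth x i < tnth a i + h * N%:R) -> exists k, grid_cube k x.
Proof.
move=> ax xN.
pose r i := (tnth x i - tnth a i) / h.
have r0 i : 0 <= r i by rewrite divr_ge0 ?subr_ge0 ?ax// ltW.
have rN i : (Num.truncn (r i) < N)%N.
  rewrite truncn_lt_nat// /r ltr_pdivrMr// mulrC ltrBlDl.
  exact: xN.
exists [ffun i => Ordinal (rN i)] => i; rewrite in_itv/= ffunE/=.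
have /andP[r1 r2] := truncn_itv (r0 i).
rewrite -lerBrDl mulrC -ler_pdivlMr// r1/= -ltrBlDl mulrC -ltr_pdivrMr//.
Qed.

Lemma grid_cube_inj k k' x : grid_cube k x -> grid_cube k' x -> k = k'.
Proof.
move=> kx k'x; apply/ffunP => i; apply/val_inj => /=.
have := kx i; have := k'x i; rewrite !in_itv/= => /andP[k1 k2] /andP[k3 k4].
have := le_lt_trans k1 k4; have := le_lt_trans k3 k2.
rewrite !ltrD2l !ltr_pM2l// !ltr_nat !ltnS => h1 h2.
by apply/eqP; rewrite eqn_leq h1 h2.
Qed.

Lemma measurable_grid_cube k : measurable (grid_cube k).
Proof.
exact: (@measurable_box R d (fun i => [set` `[tnth a i + h * (k i)%:R,
  tnth a i + h * (k i).+1%:R[ ])).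
Qed.

Lemma lebesgue_grid_cube k : lebesgue_tuple d (grid_cube k) = (h ^+ d)%:E.
Proof.
rewrite (@lebesgue_tuple_box R d (fun i => [set` `[tnth a i + h * (k i)%:R,
  tnth a i + h * (k i).+1%:R[ ]))//.
under eq_bigr => i _.
  rewrite lebesgue_measure_itv/= lte_fin ltrD2l ltr_pM2l// ltr_nat ltnSn.
  rewrite -EFinB opprD addrACA subrr add0r -mulrBr -natr1 addrAC subrr add0r mulr1.
  over.
by rewrite prodEFin prodr_const card_ord.
Qed.

(* Reindexing the first sum by the cyclic shift of every coordinate cancels all
   terms except those with a coordinate equal to [N.-1]. *)
Lemma grid_oscillation (f : d.-tuple R -> R) (B : R) :
  (forall x, orthant a x -> 0 <= f x <= B) ->
  N%:R * \sum_(k : {ffun 'I_d -> 'I_N})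
    (f (grid_point (fun i => k i)) - f (grid_point (fun i => (k i).+1)))
  <= B * d%:R * N%:R ^+ d.
Proof.
move=> fB.
case: N => [|n].
  rewrite mul0r !mulr_ge0 ?exprn_ge0//.
  by have := fB _ (@le_vec_refl _ _ a) => /andP[/le_trans H /H].
have B0 : 0 <= B by have := fB _ (@le_vec_refl _ _ a) => /andP[/le_trans H /H].
pose s (k : {ffun 'I_d -> 'I_n.+1}) := [ffun i => ordS (k i)].
have s_inj : injective s.
  move=> k k' /ffunP E; apply/ffunP => i.
  by have := E i; rewrite !ffunE => /(can_inj (@ordSK _)).
rewrite sumrB (reindex_inj s_inj)/= -sumrB.
(* A term with some coordinate equal to [ord_max] is at most [B]; summing over the coordinates
   bounds their number. *)
apply: (@le_trans _ _ (n.+1%:R * \sum_(k : {ffun 'I_d -> 'I_n.+1})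
    \sum_i B * (k i == ord_max)%:R)).
  rewrite ler_wpM2l ?ler0n//; apply: ler_sum => k _.
  have [/existsP[i ki]|/existsPn Hk] := boolP [exists i, k i == ord_max].
    rewrite (bigD1 i)//= ki mulr1.
    apply: (@le_trans _ _ B); last first.
      by rewrite lerDl sumr_ge0// => j _; rewrite mulr_ge0.
    have /andP[_ le1] := fB _ (orthant_grid_point (fun i => s k i)).
    have /andP[ge2 _] := fB _ (orthant_grid_point (fun i => (k i).+1)).
    by rewrite lerBlDr (le_trans le1)// lerDl.
  rewrite (_ : grid_point (fun i => s k i) = grid_point (fun i => (k i).+1)).
    by rewrite subrr sumr_ge0// => i _; rewrite mulr_ge0.
  congr grid_point; apply/funext => i; rewrite ffunE/= modn_small// ltnS.
  rewrite ltn_neqAle -ltnS ltn_ord andbT.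
  by have := Hk i; rewrite -val_eqE.
rewrite exchange_big/= mulr_sumr.
under eq_bigr => i _ do
  rewrite -mulr_sumr mulrCA card_ffun_fixed_coordinate.
by rewrite sumr_const card_ord -[X in X <= _]mulr_natr mulrAC.
Qed.

End grid.

Import HBNNSimple.

(** The density formula for sets extends to simple functions by linearity and to [u] by monotone
    convergence. *)
Lemma ge0_integral_density d (T : measurableType d) (R : realType)
    (mu nu : {measure set T -> \bar R}) (D : set T) (g : T -> R)
    (u : T -> R) :
  measurable D -> measurable_fun D g -> (forall x, D x -> 0 <= g x) ->
  (forall B, measurable B ->
     nu B = (\int[mu]_(x in D `&` B) (g x)%:E)%E) ->
  measurable_fun setT u -> (forall x, 0 <= u x) ->
  (\int[nu]_x (u x)%:E = \int[mu]_(x in D) (u x * g x)%:E)%E.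
Proof.
move=> mD mg g0 nuE mu' u0.
have mEu : measurable_fun setT (EFin \o u) by exact/measurable_EFinP.
pose f_ := nnsfun_approx measurableT mEu.
have fcvg x : ((f_ n x)%:E @[n --> \oo] --> (u x)%:E)%E.
  by apply: (cvg_nnsfun_approx measurableT mEu) => // y _; rewrite lee_fin.
have fnd x m n : (m <= n)%N -> f_ m x <= f_ n x.
  by move=> mn; exact/lefP/nd_nnsfun_approx.
transitivity (limn (fun n => \int[nu]_x (f_ n x)%:E))%E.
  rewrite -monotone_convergence//.
  - by apply: eq_integral => x _; apply/esym/cvg_lim.
  - by move=> n; exact/measurable_EFinP.
  - by move=> n x _; rewrite lee_fin.
  - by move=> x _ m n mn; rewrite lee_fin fnd.
transitivity (limn (fun n => \int[mu]_(x in D) (f_ n x * g x)%:E))%E; last first.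
  rewrite -monotone_convergence//.
  - apply: eq_integral => x _; apply/cvg_lim => //.
    under eq_fun do rewrite EFinM muleC.
    rewrite EFinM muleC; apply: cvgeZl => //; exact: fcvg.
  - move=> n; apply/measurable_EFinP; apply: measurable_funM => //.
    exact: measurable_funTS.
  - by move=> n x Dx; rewrite lee_fin mulr_ge0// g0.
  - by move=> x Dx m n mn; rewrite lee_fin ler_wpM2r ?g0// fnd.
congr (limn _); apply/funext => n; set f := f_ n.
have mpre y : measurable (f @^-1` [set y]) by exact: measurable_sfunP.
transitivity (\sum_(y \in range f) \int[nu]_x (y * \1_(f @^-1` [set y]) x)%:E)%E.
  rewrite -ge0_integral_fsum//.
  - by apply: eq_integral => x _; rewrite fsumEFin// -fimfunE.
  - by move=> y; exact/measurable_EFinP/measurable_funM.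
  - by move=> y x _; rewrite nnfun_muleindic_ge0.
transitivity (\sum_(y \in range f)
    \int[mu]_(x in D) (y * \1_(f @^-1` [set y]) x * g x)%:E)%E; last first.
  rewrite -ge0_integral_fsum//.
  - apply: eq_integral => x _; rewrite fsumEFin// [in RHS]fimfunE.
    by congr EFin; rewrite !fsbig_finite//= mulr_suml.
  - move=> y; apply/measurable_EFinP; apply: measurable_funM => //.
    by apply: measurable_funTS; exact: measurable_funM.
  - move=> y x Dx; rewrite EFinM mule_ge0 ?lee_fin ?g0//.
    exact: nnfun_muleindic_ge0.
apply: eq_fsbigr => y /[!inE] -[x0 _ yE].
have y0 : 0 <= y by rewrite -yE.
under eq_integral do rewrite EFinM.
rewrite ge0_integralZl_EFin//; last exact/measurable_EFinP.
rewrite integral_indic// setIT nuE// integral_mkcondr.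
under [RHS]eq_integral do rewrite -mulrA EFinM.
rewrite ge0_integralZl_EFin//; last 2 first.
- by move=> x Dx; rewrite lee_fin mulr_ge0 ?g0.
- by apply/measurable_EFinP; apply: measurable_funM => //; exact: measurable_funTS.
congr (_ * _)%E; apply: eq_integral => x _; rewrite patchE indicE.
by case: (x \in _); rewrite ?mul1r ?mul0r.
Qed.

(** * Bracketing the class by finitely many measurable weights *)

Section brackets.
Context {R : realType} {d : nat}.
Variables (a : d.-tuple R) (g0 : d.-tuple R -> R) (M gamma : R).
Hypotheses (hg0 : orthounimodal_density a g0) (hM : 0 < M)
  (hgamma : 0 < gamma < 1).

Let p := 1 / (1 - gamma).

Let p1 : 1 <= p.
Proof. by case/andP: hgamma => h1 h2; rewrite /p ler_pdivlMr ?mul1r; lra. Qed.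

Lemma density_gt0 x : orthant a x -> 0 < g0 x.
Proof. by have [+ _ _ _] := hg0; apply. Qed.

Lemma density_measurable : measurable_fun (orthant a) g0.
Proof. by have [_ _ + _] := hg0. Qed.

Lemma density_nonincreasing : nonincreasing_on_orthant a g0.
Proof. by have [_ + _ _] := hg0; exact: orthounimodal_nonincreasing. Qed.

(** Both constants are suprema at [a], where [g0] is largest: [(M * g0) ^ p] bounds [f], and its
    quotient by [g0], which is [M ^ p * g0 ^ (p - 1)], bounds [f / g0]; the exponents are
    nonnegative since [p >= 1]. *)
Definition shape_bound := (M * g0 a) `^ p.
Definition likelihood_bound := M `^ p * g0 a `^ (p - 1).

Lemma shape_bound_ge0 : 0 <= shape_bound. Proof. exact: powR_ge0. Qed.

Lemma likelihood_bound_ge0 : 0 <= likelihood_bound.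
Proof. by rewrite mulr_ge0 ?powR_ge0. Qed.

Lemma shape_class_bound f x : shape_class a g0 M gamma f -> orthant a x ->
  0 <= f x <= shape_bound.
Proof.
move=> [fM _] ax; have /andP[-> fx] /= := fM _ ax.
have gx := density_gt0 ax; have ga := density_gt0 (le_vec_refl a).
apply: (le_trans fx); apply: ge0_ler_powR; rewrite ?nnegrE.
- by rewrite (le_trans _ p1).
- by rewrite mulr_ge0// ltW.
- by rewrite mulr_ge0// ltW.
- by rewrite ler_pM2l// density_nonincreasing//; exact: le_vec_refl.
Qed.

Lemma shape_class_ratio_bound f x : shape_class a g0 M gamma f ->
  orthant a x -> 0 <= f x / g0 x <= likelihood_bound.
Proof.
move=> [fM _] ax; have /andP[f0 fx] := fM _ ax.
have gx := density_gt0 ax; have ga := density_gt0 (le_vec_refl a).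
rewrite divr_ge0 ?(ltW gx)//= ler_pdivrMr// (le_trans fx)// -/p.
have p0 : 0 < p by exact: lt_le_trans p1.
rewrite powRM ?(ltW hM) ?(ltW gx)// /likelihood_bound -mulrA.
rewrite ler_wpM2l ?powR_ge0// -(mulr_powRB1 (ltW gx) p0) mulrC.
rewrite ler_wpM2r ?(ltW gx)//; apply: ge0_ler_powR.
- by rewrite subr_ge0.
- by rewrite nnegrE ltW.
- by rewrite nnegrE ltW.
- by rewrite density_nonincreasing//; exact: le_vec_refl.
Qed.

Lemma shape_class_nonincreasing f : shape_class a g0 M gamma f ->
  nonincreasing_on_orthant a f.
Proof. by move=> [_]; exact: orthounimodal_nonincreasing. Qed.

(* [g] is a positive extension of [g0] outside the orthant, on which nothing is
   assumed about [g0]. *)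
Variables (g psi : d.-tuple R -> R) (c : R) (N : nat).
Hypotheses (mg : measurable_fun setT g) (gpos : forall x, 0 < g x)
  (gE : forall x, orthant a x -> g x = g0 x)
  (mpsi : measurable_fun setT psi) (psi0 : forall x, 0 <= psi x)
  (c0 : 0 < c) (N0 : (0 < N)%N).

Let h := c / N%:R.
Let h0 : 0 < h. Proof. by rewrite divr_gt0// ltr0n. Qed.

(** [psi <= c * g] bounds the cell weights by [c], so that they have all moments; [psi <= c] bounds
    their integrals by [c] times the volume of a cell. Each point of the orthant enters the core
    once [c] is large. *)
Definition core : set (d.-tuple R) := [set x | [/\ orthant a x,
  forall i, tnth x i < tnth a i + c, psi x <= c & psi x <= c * g x]].

Definition cell_weight (k : {ffun 'I_d -> 'I_N}) x :=
  psi x / g x * \1_(grid_cube a h k `&` core) x.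

Definition tail_weight x := psi x * \1_(orthant a `\` core) x.

Lemma measurable_core : measurable core.
Proof.
rewrite (_ : core = orthant a `&`
    [set x | forall i, [set` `]-oo, tnth a i + c[] (tnth x i)] `&`
    ~` [set x | c < psi x] `&` ~` [set x | 0 < psi x - c * g x]).
  apply: measurableI; first apply: measurableI; first apply: measurableI.
  - exact: measurable_orthant.
  - exact: (measurable_box (fun i => measurable_itv _)).
  - by apply: measurableC; exact: measurable_gt_level.
  - apply: measurableC; apply: measurable_gt_level.
    by apply: measurable_funB => //; exact: measurable_funM.
apply/seteqP; split => x.
  move=> [ax xc pc pg]; split; first split; first split => //.
  - by rewrite /= ltNge pc.
  - by rewrite /= subr_gt0 ltNge pg.
move=> [[[ax xc] /negP pc] /negP pg]; split => //.
- by move: pc; rewrite -leNgt.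
- by move: pg; rewrite -leNgt subr_le0.
Qed.

Lemma measurable_cell_weight k : measurable_fun setT (cell_weight k).
Proof.
have mV : measurable_fun setT (fun x => (g x)^-1).
  have -> : (fun x => (g x)^-1) = (fun x => g x `^ (-1)).
    by apply/funext => x; rewrite powR_inv1// ltW.
  exact: (measurableT_comp (measurable_powR _) mg).
apply: measurable_funM; first exact: measurable_funM.
apply: measurable_indic; apply: measurableI.
  exact: measurable_grid_cube.
exact: measurable_core.
Qed.

Lemma measurable_tail_weight : measurable_fun setT tail_weight.
Proof.
apply: measurable_funM => //; apply: measurable_indic; apply: measurableD.
  exact: measurable_orthant.
exact: measurable_core.
Qed.

Lemma cell_weight_ge0 k x : 0 <= cell_weight k x.
Proof. by rewrite mulr_ge0// divr_ge0// ltW. Qed.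

Lemma cell_weight_le k x : cell_weight k x <= c.
Proof.
rewrite /cell_weight indicE; case: (boolP (x \in _)) => [|_].
  move=> /set_mem[_ [_ _ _ pg]].
  by rewrite mulr1 ler_pdivrMr.
by rewrite mulr0 ltW.
Qed.

Lemma tail_weight_ge0 x : 0 <= tail_weight x.
Proof. by rewrite mulr_ge0. Qed.

Lemma tail_weight_le x : tail_weight x <= psi x.
Proof.
by rewrite /tail_weight indicE; case: (x \in _); rewrite ?mulr1 ?mulr0.
Qed.

Lemma cell_weight_sum (F : {ffun 'I_d -> 'I_N} -> R) k x : core x ->
  grid_cube a h k x -> \sum_k' F k' * cell_weight k' x = F k * (psi x / g x).
Proof.
move=> cx kx; rewrite (bigD1 k)//= big1 ?addr0.
  by rewrite /cell_weight indicE mem_set// mulr1.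
move=> k' k'k; rewrite /cell_weight indicE memNset ?mulr0// => -[k'x _].
by move/eqP: k'k; apply; exact: (grid_cube_inj h0 k'x kx).
Qed.

Lemma cell_weight_tail k x : ~ core x -> cell_weight k x = 0.
Proof. by move=> cx; rewrite /cell_weight indicE memNset ?mulr0// => -[]. Qed.

Lemma core_cell x : core x -> exists k, grid_cube (N := N) a h k x.
Proof.
move=> [ax xc _ _]; apply: grid_cube_cover => // i.
by rewrite /h divfK ?xc// pnatr_eq0 -lt0n.
Qed.

Let lo (k : {ffun 'I_d -> 'I_N}) := grid_point a h (fun i => k i).
Let up (k : {ffun 'I_d -> 'I_N}) := grid_point a h (fun i => (k i).+1).

Lemma bracket_lower f x : shape_class a g0 M gamma f -> orthant a x ->
  \sum_k f (up k) * cell_weight k x <= psi x * (f x / g0 x).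
Proof.
move=> Sf ax; have [cx|cx] := pselect (core x); last first.
  rewrite big1; last by move=> k _; rewrite cell_weight_tail// mulr0.
  by rewrite mulr_ge0//; have /andP[] := shape_class_ratio_bound Sf ax.
have [k kx] := core_cell cx; rewrite (cell_weight_sum _ cx kx) gE// mulrCA.
rewrite ler_wpM2l// ler_wpM2r ?invr_ge0 ?(ltW (density_gt0 ax))//.
have [_ xu] := grid_cube_le kx.
exact: (shape_class_nonincreasing Sf ax (orthant_grid_point a h0 _) xu).
Qed.

(** On the core [f] is replaced by its value at the lower corner of the cell. Off the core the cell
    weights vanish, and the tail weight takes over with the bound on [f / g0]. *)
Lemma bracket_upper f x : shape_class a g0 M gamma f -> orthant a x ->
  psi x * (f x / g0 x) <=
  \sum_k f (lo k) * cell_weight k x + likelihood_bound * tail_weight x.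
Proof.
move=> Sf ax; have [cx|cx] := pselect (core x); last first.
  rewrite big1 ?add0r; last by move=> k _; rewrite cell_weight_tail// mulr0.
  rewrite /tail_weight indicE mem_set ?mulr1 1?mulrC//.
  by rewrite ler_wpM2r//; have /andP[] := shape_class_ratio_bound Sf ax.
have [k kx] := core_cell cx; rewrite (cell_weight_sum _ cx kx) gE//.
rewrite [in X in _ <= X]mulrCA ler_wpDr//.
  by rewrite mulr_ge0 ?likelihood_bound_ge0 ?tail_weight_ge0.
rewrite ler_wpM2l// ler_wpM2r ?invr_ge0 ?(ltW (density_gt0 ax))//.
have [xl _] := grid_cube_le kx.
exact: (shape_class_nonincreasing Sf (orthant_grid_point a h0 _) ax xl).
Qed.

Definition weight_integral (u : d.-tuple R -> R) : \bar R :=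
  (\int[lebesgue_tuple d]_(x in orthant a) (u x * g0 x)%:E)%E.

Lemma weight_integral_sum (I : Type) (r : seq I) (F : I -> R)
    (u : I -> d.-tuple R -> R) :
  (forall k, 0 <= F k) -> (forall k, measurable_fun setT (u k)) ->
  (forall k x, 0 <= u k x) -> (forall k, weight_integral (u k) \is a fin_num) ->
  weight_integral (fun x => \sum_(k <- r) F k * u k x) =
  (\sum_(k <- r) F k * fine (weight_integral (u k)))%:E.
Proof.
move=> F0 mu' u0 ufin.
have mug k : measurable_fun (orthant a) (fun x => (u k x * g0 x)%:E).
  apply/measurable_EFinP; apply: measurable_funM; first exact: measurable_funTS.
  exact: density_measurable.
transitivity (\int[lebesgue_tuple d]_(x in orthant a)
    \sum_(k <- r) ((F k)%:E * (u k x * g0 x)%:E))%E.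
  apply: eq_integral => x _; rewrite mulr_suml -sumEFin.
  by apply: eq_bigr => k _; rewrite -EFinM mulrA.
rewrite ge0_integral_sum//.
- rewrite -sumEFin; apply: eq_bigr => k _.
  rewrite ge0_integralZl_EFin//.
  + by rewrite EFinM fineK.
  + exact: measurable_orthant.
  + by move=> x ax; rewrite lee_fin mulr_ge0// ltW// density_gt0.
- exact: measurable_orthant.
- by move=> k; exact: measurable_funeM.
- by move=> k x ax; rewrite -EFinM lee_fin !mulr_ge0// ltW// density_gt0.
Qed.

Lemma weight_integral_cell k : weight_integral (cell_weight k) \is a fin_num
  /\ 0 <= fine (weight_integral (cell_weight k)) <= c * h ^+ d.
Proof.
have W0 : (0 <= weight_integral (cell_weight k))%E.
  apply: integral_ge0 => x ax.
  by rewrite lee_fin mulr_ge0 ?cell_weight_ge0// ltW// density_gt0.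
have Wle : (weight_integral (cell_weight k) <= (c * h ^+ d)%:E)%E.
  rewrite EFinM -(lebesgue_grid_cube a h0 k).
  rewrite -(setIidl (@grid_cube_orthant _ _ _ _ _ h0 k)).
  rewrite -integral_indic; last 2 first.
  - exact: measurable_orthant.
  - exact: measurable_grid_cube.
  rewrite -ge0_integralZl_EFin ?(ltW c0)//; last 2 first.
  - exact: measurable_orthant.
  - apply/measurable_EFinP; apply: measurable_indic.
    exact: measurable_grid_cube.
  apply: ge0_le_lower_integral => x ax.
    by rewrite lee_fin mulr_ge0 ?cell_weight_ge0// ltW// density_gt0.
  rewrite -EFinM lee_fin /cell_weight !indicE.
  have [/set_mem[kx [_ _ pc _]]|_] := boolP (x \in _ `&` _).
    by rewrite mulr1 mem_set// mulr1 gE// divfK// gt_eqF// density_gt0.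
  by rewrite mulr0 mul0r mulr_ge0// ltW.
have Wfin : weight_integral (cell_weight k) \is a fin_num.
  by rewrite ge0_fin_numE// (le_lt_trans Wle)// ltry.
by split => //; rewrite fine_ge0//= -lee_fin fineK.
Qed.

(** Empirical and exact moments lie between brackets with the same coefficients. The first term
    collects the [N ^ d] deviations of cell averages; the second is the gap between the brackets, an
    oscillation of order [N ^ (d - 1)] times cell integrals of order [(c / N) ^ d]; the third bounds
    both tails. *)
Lemma uniform_bracket_error n (x : 'I_n -> d.-tuple R) (e1 e2 : R) f :
  weight_integral tail_weight \is a fin_num ->
  (0 < n)%N -> (forall i, orthant a (x i)) ->
  (forall k, `|n%:R^-1 * (\sum_i cell_weight k (x i)) -
               fine (weight_integral (cell_weight k))| <= e1) ->
  `|n%:R^-1 * (\sum_i tail_weight (x i)) -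
    fine (weight_integral tail_weight)| <= e2 ->
  shape_class a g0 M gamma f ->
  `|n%:R^-1 * (\sum_i psi (x i) * (f (x i) / g0 (x i))) -
    fine (weight_integral (fun x => psi x * (f x / g0 x)))| <=
  shape_bound * N%:R ^+ d * e1 + c * c ^+ d * shape_bound * d%:R / N%:R +
  likelihood_bound * (fine (weight_integral tail_weight) + e2).
Proof.
move=> tfin n0 ax H1 H2 Sf.
set W := fun k => fine (weight_integral (cell_weight k)).
set t := fine _ in H2 *.
pose Wn k := n%:R^-1 * \sum_i cell_weight k (x i).
pose tn := n%:R^-1 * \sum_i tail_weight (x i).
have fb y : orthant a y -> 0 <= f y <= shape_bound.
  exact: shape_class_bound.
have flo k : 0 <= f (lo k) <= shape_bound.
  by apply: fb; exact: orthant_grid_point.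
have fup k : 0 <= f (up k) <= shape_bound.
  by apply: fb; exact: orthant_grid_point.
have flo0 k : 0 <= f (lo k) by have /andP[] := flo k.
have fup0 k : 0 <= f (up k) by have /andP[] := fup k.
have ni0 : 0 <= n%:R^-1 :> R by rewrite invr_ge0.
have avg (F : {ffun 'I_d -> 'I_N} -> R) :
    n%:R^-1 * \sum_i \sum_k F k * cell_weight k (x i) = \sum_k F k * Wn k.
  rewrite exchange_big/= mulr_sumr; apply: eq_bigr => k _.
  by rewrite -mulr_sumr mulrCA.
set En := n%:R^-1 * _.
have En_lo : \sum_k f (up k) * Wn k <= En.
  rewrite -avg ler_wpM2l//; apply: ler_sum => i _; exact: bracket_lower.
have En_up : En <= \sum_k f (lo k) * Wn k + likelihood_bound * tn.
  rewrite -avg /tn mulrCA -mulrDr ler_wpM2l// mulr_sumr -big_split/=.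
  by apply: ler_sum => i _; exact: bracket_upper.
have Wfin k := (weight_integral_cell k).1.
pose I := weight_integral (fun x => psi x * (f x / g0 x)).
have I_lo : ((\sum_k f (up k) * W k)%:E <= I)%E.
  rewrite -(@weight_integral_sum _ _ (fun k => f (up k)) cell_weight)//.
  - apply: ge0_le_lower_integral => y ay; rewrite lee_fin.
      rewrite mulr_ge0 ?(ltW (density_gt0 ay))//.
      by apply: sumr_ge0 => k _; rewrite mulr_ge0 ?cell_weight_ge0.
    by rewrite ler_wpM2r ?(ltW (density_gt0 ay))// bracket_lower.
  - exact: measurable_cell_weight.
  - exact: cell_weight_ge0.
have I_up : (I <= (\sum_k f (lo k) * W k + likelihood_bound * t)%:E)%E.
  (* The index [None] carries the tail, so that the whole upper bracket is one weighted sum. *)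
  pose u (o : option {ffun 'I_d -> 'I_N}) :=
    if o is Some k then cell_weight k else tail_weight.
  pose F (o : option {ffun 'I_d -> 'I_N}) :=
    if o is Some k then f (lo k) else likelihood_bound.
  pose r := None :: [seq Some k | k <- index_enum {ffun 'I_d -> 'I_N}].
  have -> : \sum_k f (lo k) * W k + likelihood_bound * t =
      \sum_(o <- r) F o * fine (weight_integral (u o)).
    by rewrite big_cons big_map addrC.
  rewrite -weight_integral_sum.
  - apply: ge0_le_lower_integral => y ay; rewrite lee_fin.
      rewrite mulr_ge0 ?(ltW (density_gt0 ay))// mulr_ge0//.
      by have /andP[] := shape_class_ratio_bound Sf ay.
    rewrite ler_wpM2r ?(ltW (density_gt0 ay))// big_cons big_map addrC.
    exact: bracket_upper.
  - by case=> [k|] //=; exact: likelihood_bound_ge0.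
  - by case=> [k|]; [exact: measurable_cell_weight|exact: measurable_tail_weight].
  - by case=> [k|] y; [exact: cell_weight_ge0|exact: tail_weight_ge0].
  - by case=> [k|] //; exact: Wfin.
have Ifin : I \is a fin_num.
  by rewrite fin_real// (lt_le_trans _ I_lo) ?ltNyr// (le_lt_trans I_up) ?ltry.
set J := fine _.
have {}I_lo : \sum_k f (up k) * W k <= J by rewrite -lee_fin fineK.
have {}I_up : J <= \sum_k f (lo k) * W k + likelihood_bound * t.
  by rewrite -lee_fin fineK.
have dev (F : {ffun 'I_d -> 'I_N} -> R) : (forall k, 0 <= F k <= shape_bound) ->
    `|\sum_k F k * Wn k - \sum_k F k * W k| <= shape_bound * N%:R ^+ d * e1.
  move=> F0; rewrite -sumrB (le_trans (ler_norm_sum _ _ _))//.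
  apply: (@le_trans _ _ (\sum_(k : {ffun 'I_d -> 'I_N}) shape_bound * e1)).
    apply: ler_sum => k _; rewrite -mulrBr normrM.
    have /andP[Fk0 Fk1] := F0 k.
    by rewrite (ger0_norm Fk0) ler_pM// H1.
  rewrite sumr_const -[X in X <= _]mulr_natr card_ffun !card_ord natrX.
  by rewrite mulrAC.
have osc : \sum_k (f (lo k) - f (up k)) * W k <=
    c * c ^+ d * shape_bound * d%:R / N%:R.
  apply: (@le_trans _ _ (\sum_k (f (lo k) - f (up k)) * (c * h ^+ d))).
    apply: ler_sum => k _; apply: ler_wpM2l.
      rewrite subr_ge0; apply: (shape_class_nonincreasing Sf).
      - exact: orthant_grid_point.
      - exact: orthant_grid_point.
      - by move=> i; rewrite !tnth_mktuple lerD2l ler_wpM2l ?ler_nat// ltW.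
    by have [_ /andP[]] := weight_integral_cell k.
  rewrite -mulr_suml.
  have Np : 0 < N%:R :> R by rewrite ltr0n.
  rewrite ler_pdivlMr// mulrAC [_ * N%:R]mulrC.
  apply: (@le_trans _ _ (shape_bound * d%:R * N%:R ^+ d * (c * h ^+ d))).
    rewrite ler_wpM2r ?mulr_ge0 ?exprn_ge0 ?(ltW c0) ?(ltW h0)//.
    exact: grid_oscillation.
  rewrite /h expr_div_n le_eqVlt; apply/orP; left; apply/eqP.
  by field; rewrite expf_neq0// gt_eqF.
have oscE : \sum_k (f (lo k) - f (up k)) * W k =
    \sum_k f (lo k) * W k - \sum_k f (up k) * W k.
  by rewrite -sumrB; apply: eq_bigr => k _; rewrite mulrBl.
rewrite oscE in osc.
have := dev _ flo; have := dev _ fup; rewrite !ler_norml.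
move=> /andP[d1 d2] /andP[d3 d4].
move: H2; rewrite -/tn ler_norml => /andP[t1 t2].
have CL0 := likelihood_bound_ge0.
have e20 : 0 <= e2 by lra.
have CLt : likelihood_bound * tn <= likelihood_bound * (t + e2).
  by rewrite ler_wpM2l//; lra.
have CLt' : likelihood_bound * t <= likelihood_bound * (t + e2).
  by rewrite ler_wpM2l//; lra.
move: osc d1 d2 d3 d4 CLt CLt' I_lo I_up En_lo En_up.
move: (_ / N%:R) (_ * e1) (likelihood_bound * tn) (likelihood_bound * t)
  (likelihood_bound * (t + e2)) => o ee ltn lt lte.
by move=> *; apply/andP; split; lra.
Qed.

End brackets.

(** * Uniform law of large numbers *)

Section eventually_almost_surely.
Context {dO : measure_display} {Omega : measurableType dO} {R : realType}.
Variable P : probability Omega R.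

(* [Q n] need not be measurable, hence the measurable events inside it. *)
Definition eventually_as (Q : nat -> Omega -> Prop) :=
  exists E : nat -> set Omega, [/\ forall n, measurable (E n),
    forall n, E n `<=` Q n & {ae P, forall w, \forall n \near \oo, E n w}].

(** The implication is asked for positive [n] only; emptying the event at [n = 0] does not affect an
    eventual statement. *)
Lemma eventually_as_mono (Q Q' : nat -> Omega -> Prop) :
  (forall n w, (0 < n)%N -> Q n w -> Q' n w) ->
  eventually_as Q -> eventually_as Q'.
Proof.
move=> QQ' [E [mE EQ aeE]].
exists (fun n => if (0 < n)%N then E n else set0); split.
- by move=> n; case: ifP => _; [exact: mE|exact: measurable0].
- by move=> n w; case: ifP => // n0 /EQ; exact: QQ'.
- apply: filterS aeE => w Ew; near=> n.
  have n0 : (0 < n)%N by near: n; exact: nbhs_infty_gt.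
  by rewrite n0; near: n.
Unshelve. all: by end_near. Qed.

Lemma eventually_as_and (Q Q' : nat -> Omega -> Prop) :
  eventually_as Q -> eventually_as Q' ->
  eventually_as (fun n w => Q n w /\ Q' n w).
Proof.
move=> [E [mE EQ aeE]] [E' [mE' EQ' aeE']].
exists (fun n => E n `&` E' n); split.
- by move=> n; exact: measurableI.
- by move=> n w [/EQ ? /EQ' ?].
- by apply: filterS2 aeE aeE' => w; exact: filterI.
Qed.

Lemma eventually_as_all (I : Type) (s : seq I) (Q : I -> nat -> Omega -> Prop) :
  (forall i, eventually_as (Q i)) ->
  eventually_as (fun n w => forall i, List.In i s -> Q i n w).
Proof.
move=> HQ; elim: s => [|i s IH].
  exists (fun=> setT); split; [by move=> n; exact: measurableT|by move=> n w _ i []|].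
  by apply: aeW => w; exact: nearW.
apply: eventually_as_mono (eventually_as_and (HQ i) IH) => n w _ [Qi Qs] j.
by case=> [<-|] //; exact: Qs.
Qed.

Lemma eventually_as_forall (I : finType) (Q : I -> nat -> Omega -> Prop) :
  (forall i, eventually_as (Q i)) ->
  eventually_as (fun n w => forall i, Q i n w).
Proof.
move=> /(eventually_as_all (enum I)); apply: eventually_as_mono => n w _ H i.
apply: H; have := mem_enum I i; rewrite inE.
elim: (enum I) => //= j s IH; rewrite inE => /orP[/eqP ->|/IH]; by [left|right].
Qed.

(** The whole space is not null. This extracts a single sample on which empirical moments
    approximate the exact ones. *)
Lemma eventually_as_inhabited (Q : nat -> Omega -> Prop) :
  eventually_as Q -> exists n w, Q n w.
Proof.
move=> [E [mE EQ aeE]]; apply: contrapT => nQ.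
suff : P setT = 0%E.
  by rewrite probability_setT => /eqP; rewrite onee_eq0.
apply/negligibleP; first exact: measurableT.
apply: negligibleS aeE => w _ /= [n _ /(_ n (leqnn n)) /EQ Qn].
by apply: nQ; exists n, w.
Qed.

End eventually_almost_surely.

Section uniform_law.
Context {dO : measure_display} {Omega : measurableType dO} {R : realType}
  {d : nat}.
Variables (P : probability Omega R) (a : d.-tuple R) (g0 : d.-tuple R -> R)
  (M gamma : R) (X : nat -> {RV P >-> d.-tuple R}).
Hypotheses (hg0 : orthounimodal_density a g0) (hM : 0 < M)
  (hgamma : 0 < gamma < 1) (hX : iid_sample a g0 X).

Lemma iid_identically_distributed : identically_distributed X.
Proof.
have [_ + _] := hX => hd i A mA.
by have := hd i A mA; rewrite -(hd 0%N A mA).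
Qed.

Lemma iid_pairwise_independent : pairwise_independent X.
Proof.
have [_ _ ind] := hX => i j A B ij mA mB.
pose C k := if k == i then A else B.
have := ind [:: i; j] C; rewrite /= inE ij => /(_ isT).
rewrite !big_cons big_nil mule1 /C eqxx eq_sym (negbTE ij) => <-.
  congr (P _); apply/seteqP; split => w /=.
    move=> [Aw Bw] k; rewrite /= ?inE => /orP[/eqP ->|/eqP ->].
      by rewrite eqxx.
    by rewrite eq_sym (negbTE ij).
  move=> H; split.
    by have := H i; rewrite /= ?inE eqxx; apply.
  by have := H j; rewrite /= ?inE eqxx orbT eq_sym (negbTE ij); apply.
by move=> k; case: ifP.
Qed.

Lemma expectation_weight_integral (u : d.-tuple R -> R) i :
  measurable_fun setT u -> (forall x, 0 <= u x) ->
  (\int[P]_w (u (X i w))%:E = weight_integral a g0 u)%E.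
Proof.
move=> mu u0; have [_ hd _] := hX.
transitivity (\int[distribution P (X i)]_x (u x)%:E)%E.
  by rewrite ge0_integral_distribution//; exact/measurable_EFinP.
apply: ge0_integral_density => //.
- exact: measurable_orthant.
- exact: density_measurable hg0.
- by move=> x ax; rewrite ltW// (density_gt0 hg0).
- exact: hd.
Qed.

Lemma average_eventually_as (u : d.-tuple R -> R) (delta eps : R) :
  measurable_fun setT u -> (forall x, 0 <= u x) -> 0 < delta ->
  (weight_integral a g0 (fun x => (u x `^ (1 + delta))%R) < +oo)%E -> 0 < eps ->
  eventually_as P (fun n w => `|n%:R^-1 * (\sum_(i < n) u (X i w)) -
    fine (weight_integral a g0 u)| <= eps).
Proof.
move=> mu u0 d0 hu e0.
pose D n w := `|n%:R^-1 * (\sum_(i < n) u (X i w)) -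
  fine (weight_integral a g0 u)|.
exists (fun n => ~` [set w | eps < D n w]); split.
- move=> n; apply: measurableC; apply: measurable_gt_level.
  apply: measurableT_comp => //; apply: measurable_funB => //.
  apply: measurable_funM => //; apply: measurable_sum => i.
  exact: measurableT_comp.
- by move=> n w /= /negP; rewrite -leNgt.
have mup : measurable_fun setT (fun x => u x `^ (1 + delta)).
  exact: measurableT_comp (measurable_powR _) mu.
have hup : (\int[P]_w (u (X 0%N w) `^ (1 + delta))%:E < +oo)%E.
  by rewrite (expectation_weight_integral 0%N mup)// => x; exact: powR_ge0.
have [N [mN N0 sub]] := strong_law iid_identically_distributed
  iid_pairwise_independent mu u0 d0 hup e0.
exists N; split=> //.
apply: subset_trans sub => w /= nH H; apply: nH.
apply: filterS H => n; rewrite (expectation_weight_integral 0%N mu u0).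
by rewrite leNgt => /negP.
Qed.

Lemma weight_integral_moment (u : d.-tuple R -> R) (delta : R) :
  measurable_fun setT u -> (forall x, 0 <= u x) -> 0 < delta ->
  (weight_integral a g0 (fun x => (u x `^ (1 + delta))%R) < +oo)%E ->
  (weight_integral a g0 u < +oo)%E.
Proof.
move=> mu u0 d0; have mup : measurable_fun setT (fun x => u x `^ (1 + delta)).
  exact: measurableT_comp (measurable_powR _) mu.
rewrite -(expectation_weight_integral 0%N mup); last by move=> x; exact: powR_ge0.
rewrite -(expectation_weight_integral 0%N mu)// => hu.
apply: (@le_lt_trans _ _
    (\int[P]_w (1%:E + (u (X 0%N w) `^ (1 + delta))%:E))%E).
  apply: ge0_le_lower_integral => w _; first by rewrite lee_fin.
  rewrite -EFinD lee_fin; set x := u _.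
  have [x1|x1] := leP x 1; first by rewrite (le_trans x1)// lerDl powR_ge0.
  apply: (@le_trans _ _ (x `^ (1 + delta))); last by rewrite lerDr.
  by apply: le1r_powR; [exact: ltW|rewrite lerDl ltW].
rewrite ge0_integralD//.
- rewrite integral_cst// [X in (_ * X)%E](probability_setT P) mule1.
  by rewrite lte_add_pinfty// ltry.
- by move=> w _; rewrite lee_fin powR_ge0.
- by apply/measurable_EFinP; exact: (measurableT_comp mup).
Qed.

(** Dominated convergence along [c = n.+1]: the tail weights vanish eventually at each point of the
    orthant and stay below [psi]. *)
Lemma tail_weight_small (g psi : d.-tuple R -> R) (eps : R) :
  measurable_fun setT g -> (forall x, 0 < g x) -> measurable_fun setT psi ->
  (forall x, 0 <= psi x) -> (weight_integral a g0 psi < +oo)%E -> 0 < eps ->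
  exists2 c, 0 < c &
    (weight_integral a g0 (tail_weight a g psi c) <= eps%:E)%E.
Proof.
move=> mg gpos mpsi psi0 ipsi e0.
pose F n x := (tail_weight a g psi n.+1%:R x * g0 x)%:E.
have mD := measurable_orthant a.
have mg0 := density_measurable hg0.
have mF n : measurable_fun (orthant a) (F n).
  apply/measurable_EFinP; apply: measurable_funM => //.
  by apply: measurable_funTS; exact: measurable_tail_weight.
have intpsi : (lebesgue_tuple d).-integrable (orthant a)
    (fun x => (psi x * g0 x)%:E).
  apply/integrableP; split.
    apply/measurable_EFinP; apply: measurable_funM => //.
    exact: measurable_funTS.
  rewrite (eq_integral (fun x => (psi x * g0 x)%:E))//.
  move=> x /set_mem ax; rewrite gee0_abs// lee_fin mulr_ge0// ltW//.
  exact: density_gt0 hg0 _ ax.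
have cvg0 x : orthant a x -> F n x @[n --> \oo] --> 0%E.
  move=> ax.
  (* [s] dominates every coordinate of [x - a], [psi x] and [psi x / g x] at once, so [x] is in the
     core as soon as [c > s]. *)
  pose s := \sum_i `|tnth x i - tnth a i| + psi x + psi x / g x.
  apply: cvg_near_cst; near=> n.
  have sn : s < n.+1%:R.
    apply: (@lt_le_trans _ _ (Num.truncn s).+1%:R); first exact: truncnS_gt.
    rewrite ler_nat ltnS; near: n; exact: nbhs_infty_ge.
  have pg0 : 0 <= psi x / g x by rewrite divr_ge0// ltW.
  have sum0 : 0 <= \sum_i `|tnth x i - tnth a i| by exact: sumr_ge0.
  have cx : core a g psi n.+1%:R x.
    split => //.
    - move=> i; rewrite -ltrBlDl; apply: le_lt_trans sn.
      apply: (le_trans (ler_norm _)); rewrite /s -addrA (bigD1 i)//= -addrA.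
      by rewrite lerDl addr_ge0 ?addr_ge0 ?sumr_ge0.
    - by rewrite ltW// (le_lt_trans _ sn)// /s; have := psi0 x; lra.
    - rewrite -ler_pdivrMr// ltW// (le_lt_trans _ sn)// /s.
      by have := psi0 x; lra.
  rewrite /F /tail_weight indicE memNset ?mulr0 ?mul0r//.
  by move=> [].
have dom : {ae lebesgue_tuple d, forall x n, orthant a x ->
    (`|F n x| <= (psi x * g0 x)%:E)%E}.
  apply: aeW => x n ax; have gx := density_gt0 hg0 ax.
  rewrite gee0_abs lee_fin.
    by rewrite ler_wpM2r ?(ltW gx)// tail_weight_le.
  by rewrite mulr_ge0 ?(ltW gx)// tail_weight_ge0.
have [_ _] := @dominated_convergence _ _ _ (lebesgue_tuple d) (orthant a) mD
  F (cst 0%E) (fun x => (psi x * g0 x)%:E) mF (measurable_cst _)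
  (aeW _ cvg0) intpsi dom.
rewrite integral0 => cvgF.
have e0' : (0 < eps%:E)%E by rewrite lte_fin.
have [n _ Hn] := cvgF _ (open_ereal_lt' e0').
by exists n.+1%:R => //; exact: ltW (Hn n (leqnn n)).
Unshelve. all: by end_near. Qed.


End uniform_law.

Section uniform_law_of_large_numbers.
Context {dO : measure_display} {Omega : measurableType dO} {R : realType}
  {d : nat}.
Variables (P : probability Omega R) (a : d.-tuple R) (g0 : d.-tuple R -> R)
  (M gamma : R) (X : nat -> {RV P >-> d.-tuple R}).
Hypotheses (hg0 : orthounimodal_density a g0) (hM : 0 < M)
  (hgamma : 0 < gamma < 1) (hX : iid_sample a g0 X).

Let CL := likelihood_bound a g0 M gamma.
Let CL0 : 0 <= CL. Proof. exact: likelihood_bound_ge0. Qed.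

Let wintegral := weight_integral a g0.

Lemma weight_integral_ratio_le (psi f : d.-tuple R -> R) :
  measurable_fun setT psi -> (forall x, 0 <= psi x) ->
  shape_class a g0 M gamma f ->
  (0 <= wintegral (fun x => (psi x * (f x / g0 x))%R) <=
   CL%:E * wintegral psi)%E.
Proof.
move=> mpsi psi0 Sf; apply/andP; split.
  apply: integral_ge0 => x ax; have gx := density_gt0 hg0 ax.
  have /andP[f0 _] := shape_class_ratio_bound hg0 hM hgamma Sf ax.
  by rewrite lee_fin mulr_ge0 ?(ltW gx)// mulr_ge0.
rewrite /wintegral /weight_integral -ge0_integralZl_EFin//; last 3 first.
- exact: measurable_orthant.
- by move=> x ax; rewrite lee_fin mulr_ge0// ltW// (density_gt0 hg0).
- apply/measurable_EFinP; apply: measurable_funM; first exact: measurable_funTS.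
  exact: density_measurable hg0.
apply: ge0_le_lower_integral => x ax; have gx := density_gt0 hg0 ax;
  have /andP[f0 f1] := shape_class_ratio_bound hg0 hM hgamma Sf ax.
  by rewrite lee_fin mulr_ge0 ?(ltW gx)// mulr_ge0.
rewrite -EFinM lee_fin [leRHS]mulrA ler_wpM2r ?(ltW gx)// [leRHS]mulrC.
by rewrite ler_wpM2l.
Qed.

(** The parameters depend on each other in this order: [c] makes the tail integral small, then [N]
    makes the gap between the brackets small for this [c], and [e1] makes the [N ^ d] cell
    deviations small. Tail, gap and cells get [eta / 2], [eta / 4] and [eta / 4]; the summands 1 in
    [CL + 1] and [B + 1] keep the denominators positive. *)
Lemma uniform_law_ge0 (psi : d.-tuple R -> R) (delta eta : R) :
  measurable_fun setT psi -> (forall x, 0 <= psi x) -> 0 < delta ->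
  (wintegral (fun x => (psi x `^ (1 + delta))%R) < +oo)%E -> 0 < eta ->
  eventually_as P (fun n w => forall f, shape_class a g0 M gamma f ->
    `|n%:R^-1 * (\sum_(i < n) psi (X i w) * (f (X i w) / g0 (X i w))) -
      fine (wintegral (fun x => psi x * (f x / g0 x)))| <= eta).
Proof.
move=> mpsi psi0 d0 ipsi eta0.
have mD := measurable_orthant a.
pose g x := (g0 \_ (orthant a)) x + \1_(~` orthant a) x.
have mg : measurable_fun setT g.
  apply: measurable_funD; last by apply: measurable_indic; exact: measurableC.
  exact: ((measurable_restrictT g0 mD).1 (density_measurable hg0)).
have gE x : orthant a x -> g x = g0 x.
  move=> ax; have nax : ~ (~` orthant a) x by apply.
  by rewrite /g patchE (mem_set ax) indicE (memNset nax) addr0.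
have gpos x : 0 < g x.
  have [ax|ax] := pselect (orthant a x); first by rewrite gE// (density_gt0 hg0).
  by rewrite /g patchE (memNset ax) add0r indicE mem_set.
pose B := shape_bound a g0 M gamma.
have B0 : 0 <= B by exact: shape_bound_ge0.
pose e2 := eta / (4 * (CL + 1)).
have cl0 : 0 <= CL := CL0.
have CL1 : 0 < 4 * (CL + 1) by lra.
have e20 : 0 < e2 by exact: divr_gt0.
have e2E : e2 * (4 * (CL + 1)) = eta by rewrite /e2 divfK ?gt_eqF.
have [c c0 Hc] := tail_weight_small hg0 mg gpos mpsi psi0
  (weight_integral_moment hg0 hX mpsi psi0 d0 ipsi) e20.
pose C := c * c ^+ d * B * d%:R.
have C0 : 0 <= C by rewrite !mulr_ge0 ?exprn_ge0// ltW.
pose N := (Num.truncn (4 * C / eta)).+1.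
have N0 : (0 < N)%N by [].
have Np : 0 < N%:R :> R by rewrite ltr0n.
have CN : C / N%:R <= eta / 4.
  have : 4 * C / eta < N%:R by exact: truncnS_gt.
  rewrite ltr_pdivrMr// ler_pdivrMr// => /ltW.
  by set x := N%:R => H; rewrite mulrAC ler_pdivlMr//; lra.
have Nd : 0 < N%:R ^+ d :> R by exact: exprn_gt0.
pose e1 := eta / (4 * (B + 1) * N%:R ^+ d).
have e10 : 0 < e1 by rewrite divr_gt0// mulr_gt0//; lra.
have e1E : B * N%:R ^+ d * e1 <= eta / 4.
  have -> : B * N%:R ^+ d * e1 = B / (B + 1) * (eta / 4).
    by rewrite /e1; field; rewrite expf_neq0 ?gt_eqF//=; lra.
  by rewrite ler_piMl ?divr_ge0 ?(ltW eta0)// ler_pdivrMr; lra.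
have tail0 x : 0 <= tail_weight a g psi c x by exact: tail_weight_ge0.
have mtail : measurable_fun setT (tail_weight a g psi c).
  exact: measurable_tail_weight.
have Wt0 : (0 <= wintegral (tail_weight a g psi c))%E.
  apply: integral_ge0 => x ax; rewrite lee_fin mulr_ge0// ltW//.
  exact: density_gt0 hg0 _ ax.
have tfin : wintegral (tail_weight a g psi c) \is a fin_num.
  by rewrite ge0_fin_numE// (le_lt_trans Hc)// ltry.
have cell k : eventually_as P (fun n w =>
    `|n%:R^-1 * (\sum_(i < n) @cell_weight _ _ a g psi c N k (X i w)) -
      fine (wintegral (@cell_weight _ _ a g psi c N k))| <= e1).
  have mk : measurable_fun setT (@cell_weight _ _ a g psi c N k).
    exact: measurable_cell_weight.
  have k0 := @cell_weight_ge0 _ _ a g psi c N gpos psi0 k.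
  apply: (average_eventually_as hg0 hX mk k0 d0) => //.
  rewrite -(expectation_weight_integral hg0 hX 0%N); last first.
  - by move=> x; exact: powR_ge0.
  - exact: measurableT_comp (measurable_powR _) mk.
  apply: (@le_lt_trans _ _ (\int[P]_w (c `^ (1 + delta))%:E)%E).
    apply: ge0_le_lower_integral => w _; rewrite lee_fin ?powR_ge0//.
    apply: ge0_ler_powR; rewrite ?nnegrE ?k0 ?(ltW c0)//.
      by rewrite addr_ge0// ltW.
    exact: cell_weight_le.
  by rewrite integral_cst// [X in (_ * X)%E](probability_setT P) mule1 ltry.
have tail : eventually_as P (fun n w =>
    `|n%:R^-1 * (\sum_(i < n) tail_weight a g psi c (X i w)) -
      fine (wintegral (tail_weight a g psi c))| <= e2).
  apply: (average_eventually_as hg0 hX mtail tail0 d0) => //.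
  apply: le_lt_trans ipsi; apply: ge0_le_lower_integral => x ax;
    have gx := density_gt0 hg0 ax; rewrite lee_fin.
    by rewrite mulr_ge0 ?powR_ge0// ltW.
  rewrite ler_wpM2r ?(ltW gx)//; apply: ge0_ler_powR; rewrite ?nnegrE//.
    by rewrite addr_ge0// ltW.
  exact: tail_weight_le.
apply: eventually_as_mono (eventually_as_and (eventually_as_forall cell) tail).
move=> n w n0 [Hcell Htail] f Sf; have [aX _ _] := hX.
apply: (le_trans (uniform_bracket_error hg0 hM hgamma mg gpos gE mpsi psi0 c0 N0
  (x := fun i : 'I_n => X i w) tfin n0 (fun i => aX i w) Hcell Htail Sf)).
rewrite -/CL -/B -/C.
have {}Hc : fine (wintegral (tail_weight a g psi c)) <= e2.
  by rewrite -lee_fin fineK.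
have : CL * (fine (wintegral (tail_weight a g psi c)) + e2) <= CL * (2 * e2).
  by rewrite ler_wpM2l//; lra.
have : CL * (2 * e2) <= eta / 2.
  have -> : CL * (2 * e2) = e2 * (4 * (CL + 1)) / 2 - 2 * e2 by field.
  by rewrite e2E; lra.
move: e1E CN; rewrite /wintegral.
move: (_ * e1) (_ / N%:R) (CL * _) (CL * _) => u1 u2 u3 u4; lra.
Qed.


End uniform_law_of_large_numbers.

Section uniform_law_signed.
Context {dO : measure_display} {Omega : measurableType dO} {R : realType}
  {d : nat}.
Variables (P : probability Omega R) (a : d.-tuple R) (g0 : d.-tuple R -> R)
  (M gamma : R) (X : nat -> {RV P >-> d.-tuple R}).
Hypotheses (hg0 : orthounimodal_density a g0) (hM : 0 < M)
  (hgamma : 0 < gamma < 1) (hX : iid_sample a g0 X).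
Variables (phi : d.-tuple R -> R) (delta : R).
Hypotheses (mphi : measurable_fun (orthant a) phi) (hdelta : 0 < delta)
  (hnorm : (norm_g0 a g0 (1 + delta) phi < +oo)%E).

(** The extension by 0 off the orthant makes both parts measurable on the whole space. *)
Let pos x := Num.max ((phi \_ (orthant a)) x) 0.
Let neg x := Num.max (- (phi \_ (orthant a)) x) 0.

Let mphiT : measurable_fun setT (phi \_ (orthant a)).
Proof. exact: ((measurable_restrictT phi (measurable_orthant a)).1 mphi). Qed.

Let mpos : measurable_fun setT pos.
Proof. by apply: measurable_maxr => //; exact: measurable_cst. Qed.

Let mneg : measurable_fun setT neg.
Proof.
apply: measurable_maxr; last exact: measurable_cst.
exact: measurableT_comp mphiT.
Qed.

Let pos0 x : 0 <= pos x. Proof. by rewrite le_max lexx orbT. Qed.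
Let neg0 x : 0 <= neg x. Proof. by rewrite le_max lexx orbT. Qed.

Let posE x : orthant a x -> pos x = Num.max (phi x) 0.
Proof. by move=> ax; rewrite /pos patchE mem_set. Qed.

Let negE x : orthant a x -> neg x = Num.max (- phi x) 0.
Proof. by move=> ax; rewrite /neg patchE mem_set. Qed.

Let phiE x : orthant a x -> phi x = pos x - neg x.
Proof.
move=> ax; rewrite posE// negE//; have [p0|p0] := leP 0 (phi x).
  have n0 : - phi x <= 0 by rewrite oppr_le0.
  by rewrite (max_idPr n0) subr0.
have n0 : 0 <= - phi x by rewrite oppr_ge0 ltW.
by rewrite (max_idPl n0) sub0r opprK.
Qed.

Let moment_norm :
  (weight_integral a g0 (fun x => (`|phi x| `^ (1 + delta))%R) < +oo)%E.
Proof.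
have := hnorm; rewrite /norm_g0 -[expect_g0 _ _ _]/(weight_integral _ _ _).
case: (weight_integral _ _ _) => [r| |] //.
  by rewrite !ltry.
by rewrite poweRyr// invr_eq0 gt_eqF// addr_gt0.
Qed.

Let moment_le (psi : d.-tuple R -> R) : (forall x, 0 <= psi x) ->
  (forall x, orthant a x -> psi x <= `|phi x|) ->
  (weight_integral a g0 (fun x => (psi x `^ (1 + delta))%R) < +oo)%E.
Proof.
move=> psi0 psile; apply: le_lt_trans moment_norm.
apply: ge0_le_lower_integral => x ax; have gx := density_gt0 hg0 ax;
  rewrite lee_fin; first by rewrite mulr_ge0 ?powR_ge0 ?(ltW gx).
rewrite ler_wpM2r ?(ltW gx)//; apply: ge0_ler_powR; rewrite ?nnegrE ?psile//.
by rewrite addr_ge0// ltW.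
Qed.

Let moment_pos :
  (weight_integral a g0 (fun x => (pos x `^ (1 + delta))%R) < +oo)%E.
Proof.
by apply: moment_le => // x ax; rewrite posE// ge_max ler_norm normr_ge0.
Qed.

Let moment_neg :
  (weight_integral a g0 (fun x => (neg x `^ (1 + delta))%R) < +oo)%E.
Proof.
apply: moment_le => // x ax; rewrite negE// ge_max normr_ge0 andbT.
by rewrite -normrN ler_norm.
Qed.

(** The integral of a signed function is defined by its positive and negative parts. As [f / g0] and
    [g0] are nonnegative, these parts come from those of [phi], whether or not [f] is measurable. *)
Let weight_integral_signed (f : d.-tuple R -> R) :
  shape_class a g0 M gamma f ->
  weight_integral a g0 (fun x => phi x * (f x / g0 x)) =
  (weight_integral a g0 (fun x => (pos x * (f x / g0 x))%R) -
   weight_integral a g0 (fun x => (neg x * (f x / g0 x))%R))%E.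
Proof.
move=> Sf; rewrite /weight_integral integralE; congr (_ - _)%E;
  apply: eq_integral => x /set_mem ax; have gx := ltW (density_gt0 hg0 ax);
  have /andP[v0 _] := shape_class_ratio_bound hg0 hM hgamma Sf ax.
- by rewrite funeposE -EFin_max posE// !maxr_pMl// !mul0r.
- by rewrite funenegE -EFinN -EFin_max negE// !maxr_pMl// !mul0r !mulNr.
Qed.

Let weight_integral_fin (psi f : d.-tuple R -> R) :
  measurable_fun setT psi -> (forall x, 0 <= psi x) ->
  (weight_integral a g0 (fun x => (psi x `^ (1 + delta))%R) < +oo)%E ->
  shape_class a g0 M gamma f ->
  weight_integral a g0 (fun x => psi x * (f x / g0 x)) \is a fin_num /\
  0 <= fine (weight_integral a g0 (fun x => psi x * (f x / g0 x))) <=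
    likelihood_bound a g0 M gamma * fine (weight_integral a g0 psi).
Proof.
move=> mpsi psi0 hpsi Sf.
have ipsi := weight_integral_moment hg0 hX mpsi psi0 hdelta hpsi.
have fpsi : weight_integral a g0 psi \is a fin_num.
  rewrite ge0_fin_numE//; apply: integral_ge0 => x ax.
  by rewrite lee_fin mulr_ge0// ltW// (density_gt0 hg0).
have /andP[I0] := weight_integral_ratio_le hg0 hM hgamma mpsi psi0 Sf.
rewrite -(fineK fpsi) -EFinM => I1.
have If : weight_integral a g0 (fun x => psi x * (f x / g0 x)) \is a fin_num.
  by rewrite ge0_fin_numE// (le_lt_trans I1)// ltry.
by split => //; rewrite fine_ge0//= -lee_fin fineK.
Qed.

Lemma weight_integral_shape_bounded : exists K : R, forall f,
  shape_class a g0 M gamma f ->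
  weight_integral a g0 (fun x => phi x * (f x / g0 x)) \is a fin_num /\
  `|fine (weight_integral a g0 (fun x => phi x * (f x / g0 x)))| <= K.
Proof.
exists (likelihood_bound a g0 M gamma * fine (weight_integral a g0 pos) +
        likelihood_bound a g0 M gamma * fine (weight_integral a g0 neg)).
move=> f Sf; have [f1 /andP[b1 c1]] := weight_integral_fin mpos pos0 moment_pos Sf.
have [f2 /andP[b2 c2]] := weight_integral_fin mneg neg0 moment_neg Sf.
rewrite weight_integral_signed// fin_numB f1 f2; split=> //.
rewrite fineB// ler_norml; set K1 := _ * _ in c1 *; set K2 := _ * _ in c2 *.
by apply/andP; split; lra.
Qed.

Lemma uniform_law_shape (eta : R) : 0 < eta ->
  eventually_as P (fun n w => forall f, shape_class a g0 M gamma f ->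
    `|n%:R^-1 * (\sum_(i < n) phi (X i w) * (f (X i w) / g0 (X i w))) -
      fine (weight_integral a g0 (fun x => phi x * (f x / g0 x)))| <= eta).
Proof.
move=> eta0; have eta20 : 0 < eta / 2 by exact: divr_gt0.
have Up := uniform_law_ge0 hg0 hM hgamma hX mpos pos0 hdelta moment_pos eta20.
have Un := uniform_law_ge0 hg0 hM hgamma hX mneg neg0 hdelta moment_neg eta20.
apply: eventually_as_mono (eventually_as_and Up Un) => n w n0 [Hp Hn] f Sf.
have [f1 _] := weight_integral_fin mpos pos0 moment_pos Sf.
have [f2 _] := weight_integral_fin mneg neg0 moment_neg Sf.
rewrite weight_integral_signed// fineB//.
have -> : \sum_(i < n) phi (X i w) * (f (X i w) / g0 (X i w)) =
    \sum_(i < n) pos (X i w) * (f (X i w) / g0 (X i w)) -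
    \sum_(i < n) neg (X i w) * (f (X i w) / g0 (X i w)).
  rewrite -sumrB; apply: eq_bigr => i _; rewrite -mulrBl phiE//.
  by have [aX _ _] := hX.
rewrite mulrBr; have := Hp f Sf; have := Hn f Sf.
set A := n%:R^-1 * _; set B := fine _; set A' := n%:R^-1 * _; set B' := fine _.
rewrite !ler_norml => /andP[h1 h2] /andP[h3 h4].
by apply/andP; split; lra.
Qed.

End uniform_law_signed.

(** * Reduction to a linear program *)

Section discrete_reduction.
Context {R : realType} {d : nat}.
Variables (a : d.-tuple R) (g0 : d.-tuple R -> R) (M gamma : R).
Hypotheses (hg0 : orthounimodal_density a g0) (hM : 0 < M)
  (hgamma : 0 < gamma < 1).
Variables (n : nat) (x : 'I_n -> d.-tuple R).
Hypothesis ax : forall i, orthant a (x i).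

Lemma discrete_shape_reducible :
  finite_dim_reducible (likelihood_class a g0 M gamma) x
    (discrete_shape g0 M gamma x).
Proof.
have gx i := density_gt0 hg0 (ax i).
have p0 : 0 <= 1 / (1 - gamma).
  by case/andP: hgamma => h1 h2; rewrite divr_ge0// subr_ge0 ltW.
split=> [_ [f Sf <-]|y [ymono ybound]].
  have fx i : f (x i) / g0 (x i) * g0 (x i) = f (x i) by rewrite divfK ?gt_eqF.
  split=> [i j ji|i]; rewrite !fx.
    exact: (shape_class_nonincreasing Sf (ax j) (ax i) ji).
  by have [fM _] := Sf; exact: fM.
(* the smallest nonincreasing extension of the prescribed values *)
pose f z := \big[Num.max/0]_(i < n | `[< le_vec z (x i) >]) (y i * g0 (x i)).
have fx i : f (x i) = y i * g0 (x i).
  apply/eqP; rewrite eq_le; apply/andP; split.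
    apply: bigmax_le => [|j /asboolP ij]; last exact: ymono.
    by have /andP[] := ybound i.
  by apply: le_bigmax_cond; apply/asboolP; exact: le_vec_refl.
exists (fun z => f z / g0 z); last first.
  by move=> i; rewrite fx mulfK// gt_eqF.
exists f => //; split=> [z az|].
  rewrite bigmax_ge_id/=; apply: bigmax_le => [|i /asboolP zi].
    exact: powR_ge0.
  (* An index in the maximum has [z <= x i], hence [g0 (x i) <= g0 z], and the bound at [x i] is
     below the one at [z]. *)
  have /andP[_ yi] := ybound i; apply: (le_trans yi).
  have gz := density_gt0 hg0 az.
  apply: ge0_ler_powR => //;
    rewrite ?nnegrE ?mulr_ge0 ?(ltW hM) ?(ltW gz) ?(ltW (gx i))//.
  by rewrite ler_pM2l// (density_nonincreasing hg0).
apply: nonincreasing_orthounimodal => z z' az az' zz'.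
apply: bigmax_le => [|i /asboolP z'i]; first exact: bigmax_ge_id.
by apply: le_bigmax_cond; apply/asboolP; exact: le_vec_trans z'i.
Qed.

Lemma optval_reduction (l m : nat) (phi : nat -> d.-tuple R -> R)
    (mu : nat -> R) :
  optval l m mu (likelihood_class a g0 M gamma) (mom_Pn phi x) =
  optval l m mu (discrete_shape g0 M gamma x) (mom_Pn' phi x).
Proof.
have [to from] := discrete_shape_reducible.
rewrite /optval; congr ereal_sup; apply/seteqP; split => v.
  move=> [L [SL H1 H2] <-]; exists (fun i => L (x i)) => //.
  by split; [exact: to|exact: H1|exact: H2].
move=> [y [Dy H1 H2] <-]; have [L SL Ly] := from y Dy.
have E j : mom_Pn phi x j L = mom_Pn' phi x j y.
  by congr (_ * _)%:E; apply: eq_bigr => i _; rewrite Ly.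
by exists L => //; split=> // j jm; rewrite E; [exact: H1|exact: H2].
Qed.

Lemma discrete_problem_linear (l m : nat) (phi : nat -> d.-tuple R -> R)
    (mu : nat -> R) : (m <= l)%N ->
  is_linear_program (mom_Pn' phi x 0%N)
    (feasible l m mu (discrete_shape g0 M gamma x) (mom_Pn' phi x)).
Proof.
move=> hml.
(* [inl (j, false)] encodes a moment constraint as an upper bound and [inl (j, true)] the reverse
   bound for equalities; [inr (inl _)] is a monotonicity constraint, and [inr (inr (i, up))] an
   upper or lower bound. Pairs and indices without a constraint give [0 <= 0]. *)
pose K := ('I_l.+1 * bool + ('I_n * 'I_n + 'I_n * bool))%type.
pose A (k : K) (i : 'I_n) : R := match k with
  | inl (j, eqc) =>
      if eqc then if (m < j)%N then - (n%:R^-1 * phi j (x i)) else 0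
      else if (0 < j)%N then n%:R^-1 * phi j (x i) else 0
  | inr (inl (i1, i2)) =>
      if `[< le_vec (x i2) (x i1) >] then
        (i == i1)%:R * g0 (x i1) - (i == i2)%:R * g0 (x i2) else 0
  | inr (inr (i1, up)) =>
      if up then (i == i1)%:R * g0 (x i1) else - ((i == i1)%:R * g0 (x i1))
  end.
pose b (k : K) : R := match k with
  | inl (j, eqc) => if eqc then if (m < j)%N then - mu j else 0
      else if (0 < j)%N then mu j else 0
  | inr (inl _) => 0
  | inr (inr (i1, up)) =>
      if up then (M * g0 (x i1)) `^ (1 / (1 - gamma)) else 0
  end.
have delta_sum (y : 'I_n -> R) i1 :
    \sum_i (i == i1)%:R * g0 (x i1) * y i = y i1 * g0 (x i1).
  rewrite (bigD1 i1)//= eqxx mul1r big1 ?addr0 1?mulrC// => i /negbTE ->.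
  by rewrite !mul0r.
have mom_sum j (y : 'I_n -> R) : \sum_i n%:R^-1 * phi j (x i) * y i =
    n%:R^-1 * \sum_i phi j (x i) * y i.
  by rewrite mulr_sumr; apply: eq_bigr => i _; rewrite mulrA.
have zero_sum (y : 'I_n -> R) : \sum_i 0 * y i = 0.
  by rewrite big1// => i _; rewrite mul0r.
have neg_sum (c y : 'I_n -> R) : \sum_i - c i * y i = - \sum_i c i * y i.
  by rewrite -sumrN; apply: eq_bigr => i _; rewrite mulNr.
exists (fun i => n%:R^-1 * phi 0%N (x i)), K, A, b.
split=> [y|y]; first by rewrite mom_sum.
split=> [[[ymono ybound] Hle Heq] [[j [|]]|[[i1 i2]|[i1 [|]]]]|H] /=.
- case: ifP => [mj|_]; last by rewrite zero_sum.
  rewrite neg_sum mom_sum lerN2.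
  have := Heq j; rewrite mj -ltnS ltn_ord => /(_ isT) [->].
  exact: lexx.
- case: ifP => [j0|_]; last by rewrite zero_sum.
  rewrite mom_sum; have [jm|mj] := leqP j m.
    by have := Hle j; rewrite j0 jm => /(_ isT); rewrite lee_fin.
  have := Heq j; rewrite mj -ltnS ltn_ord => /(_ isT) [->].
  exact: lexx.
- case: asboolP => [i21|_]; last by rewrite zero_sum.
  under eq_bigr do rewrite mulrBl.
  by rewrite sumrB !delta_sum subr_le0 ymono.
- by rewrite delta_sum; have /andP[] := ybound i1.
- by rewrite neg_sum delta_sum oppr_le0; have /andP[] := ybound i1.
split.
- split=> [i1 i2 i21|i1].
    have := H (inr (inl (i1, i2))); rewrite /= asboolT//.
    under eq_bigr do rewrite mulrBl.
    by rewrite sumrB !delta_sum subr_le0.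
  have := H (inr (inr (i1, true))); have := H (inr (inr (i1, false))).
  by rewrite /= neg_sum !delta_sum oppr_le0 => -> ->.
- move=> j /andP[j0 jm]; have jl : (j < l.+1)%N by rewrite ltnS (leq_trans jm).
  have := H (inl (Ordinal jl, false)); rewrite /= j0 mom_sum => h.
  by rewrite lee_fin.
- move=> j /andP[mj jl]; have jl' : (j < l.+1)%N by [].
  have := H (inl (Ordinal jl', false)); have := H (inl (Ordinal jl', true)).
  rewrite /= mj (leq_ltn_trans (leq0n m) mj) neg_sum !mom_sum lerN2 => h1 h2.
  by congr EFin; apply/eqP; rewrite eq_le h1 h2.
Qed.

End discrete_reduction.

(** * Convergence of the optimal values *)

Section almost_sure_convergence.
Context {dO : measure_display} {Omega : measurableType dO} {R : realType}.
Variable P : probability Omega R.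

(** Minimality turns a bound on the events [E n] into one on [V n], by comparison with the
    measurable majorant [U n] that is [+oo] off [E n]. The levels [p.+1^-1] are countable, so the
    exceptional null sets can be united. *)
Lemma as_star_cvg_eventually (Z : nat -> Omega -> \bar R) (z : \bar R) :
  (forall eta : R, 0 < eta ->
     eventually_as P (fun n w => (`|Z n w - z| <= eta%:E)%E)) ->
  as_star_cvg P Z z.
Proof.
move=> HZ.
have /choice[V VP] : forall n, exists V,
    minimal_measurable_majorant P (fun w => `|Z n w - z|%E) V.
  by move=> n; exact: minimal_measurable_majorant_exists.
exists V => //.
have HV p : {ae P, forall w, \forall n \near \oo, (V n w <= p.+1%:R^-1%:E)%E}.
  have e0 : 0 < p.+1%:R^-1 :> R by rewrite invr_gt0.
  have [E [mE EQ aeE]] := HZ _ e0.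
  pose U n w := if w \in E n then p.+1%:R^-1%:E else +oo%E : \bar R.
  have mU n : measurable_fun setT (U n).
    apply: measurable_fun_ifT => //.
    apply: (measurable_fun_bool true); rewrite setTI.
    rewrite (_ : _ @^-1` _ = E n)//.
    by apply/seteqP; split => w /=; [move/set_mem|move/mem_set].
  have VU n : {ae P, forall w, (V n w <= U n w)%E}.
    have [_ _ Vmin] := VP n; apply: Vmin => //; apply: aeW => w.
    rewrite /U; case: ifPn => [/set_mem/EQ//|_]; exact: leey.
  have /ae_foralln VU' := VU.
  apply: filterS2 VU' aeE => w VUw; apply: filterS => n Enw.
  by have := VUw n; rewrite /U mem_set.
have /ae_foralln HV' := HV.
apply: filterS HV' => w Vw.
have V0 n : (0 <= V n w)%E.
  by have [_ ZV _] := VP n; exact: le_trans (abse_ge0 _) (ZV w).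
apply/fine_cvgP; split.
  apply: filterS (Vw 0%N) => n Vn.
  by rewrite ge0_fin_numE// (le_lt_trans Vn)// ltry.
apply/cvgrPdist_le => e e0.
have [p pe] : exists p, p.+1%:R^-1 <= e.
  exists (Num.truncn e^-1); rewrite invf_ple ?posrE//.
  exact/ltW/truncnS_gt.
apply: filterS (Vw p) => n Vn /=; rewrite sub0r normrN.
have fV : V n w \is a fin_num by rewrite ge0_fin_numE// (le_lt_trans Vn)// ltry.
rewrite ger0_norm ?fine_ge0// -lee_fin fineK//.
by apply: (le_trans Vn); rewrite lee_fin.
Qed.

End almost_sure_convergence.

Section likelihood_class.
Context {R : realType} {d : nat}.
Variables (a : d.-tuple R) (g0 : d.-tuple R -> R) (M gamma : R).

Lemma likelihood_class_convex : convex_closed (likelihood_class a g0 M gamma).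
Proof.
move=> t _ _ /andP[t0 t1] [f [fM fo] <-] [f' [fM' fo'] <-].
have t1' : 0 <= 1 - t by rewrite subr_ge0.
exists (fun x => t * f x + (1 - t) * f' x); last first.
  apply/funext => x.
  rewrite -[RHS]/(t * (f x / g0 x) + (1 - t) * (f' x / g0 x)).
  by rewrite mulrDl !mulrA.
split=> [x ax|].
  have /andP[f0 f1] := fM x ax; have /andP[f0' f1'] := fM' x ax.
  rewrite addr_ge0 ?mulr_ge0//=; set b := _ `^ _ in f1 f1' *.
  have -> : b = t * b + (1 - t) * b by ring.
  by rewrite lerD// ler_wpM2l.
move=> i x y ax ay xy; have [h1 h2] := fo i x y ax ay xy.
have [h1' h2'] := fo' i x y ax ay xy.
split=> h; rewrite lerD// ler_wpM2l//.
- exact: h1.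
- exact: h1'.
- exact: h2.
- exact: h2'.
Qed.

End likelihood_class.

Theorem corollary5 (R : realType) (dO : measure_display)
    (Omega : measurableType dO) (P : probability Omega R)
    (d : nat) (hd : (2 <= d)%N) (a : d.-tuple R)
    (g0 : d.-tuple R -> R) (hg0 : orthounimodal_density a g0)
    (M gamma : R) (hM : 0 < M) (hgamma : 0 < gamma < 1)
    (l m : nat) (hml : (m <= l)%N)
    (phi : nat -> d.-tuple R -> R) (mu : nat -> R)
    (hphi : forall j, (j <= l)%N -> measurable_fun (orthant a) (phi j))
    (hmass : exists2 j, (1 <= j <= l)%N &
       forall x, orthant a x -> phi j x = \1_(orthant a) x)
    (X : nat -> {RV P >-> d.-tuple R}) (hX : iid_sample a g0 X)
    (delta : R) (hdelta : 0 < delta)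
    (hnorm : forall j, (j <= l)%N -> (norm_g0 a g0 (1 + delta) (phi j) < +oo)%E)
    (hslater : exists2 L0, likelihood_class a g0 M gamma L0 &
       (forall j, (1 <= j <= m)%N -> (mom_P a g0 phi j L0 < (mu j)%:E)%E) /\
       (forall j, (m < j <= l)%N -> mom_P a g0 phi j L0 = (mu j)%:E))
    (hint : (m < l)%N ->
       interior (moment_set a g0 phi l m M gamma)
         (\row_(k < l - m) mu (m + k.+1)%N)) :
  (forall (n : nat) (w : Omega), (0 < n)%N ->
     let x := fun i : 'I_n => X i w in
     [/\ finite_dim_reducible (likelihood_class a g0 M gamma) x
           (discrete_shape g0 M gamma x),
         is_linear_program (mom_Pn' phi x 0%N)
           (feasible l m mu (discrete_shape g0 M gamma x) (mom_Pn' phi x)) &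
         optval l m mu (likelihood_class a g0 M gamma) (mom_Pn phi x) =
         optval l m mu (discrete_shape g0 M gamma x) (mom_Pn' phi x)]) /\
  as_star_cvg P
    (fun n w => optval l m mu (likelihood_class a g0 M gamma)
                  (mom_Pn phi (fun i : 'I_n => X i w)))
    (optval l m mu (likelihood_class a g0 M gamma) (mom_P a g0 phi)).
Proof.
split=> [n w n0 x|].
  have ax i : orthant a (x i) by have [aX _ _] := hX; exact: aX.
  split.
  - exact: discrete_shape_reducible.
  - exact: discrete_problem_linear.
  - exact: optval_reduction.
set S := likelihood_class a g0 M gamma.
have Sconv : convex_closed S by exact: likelihood_class_convex.
(* The value 0 beyond [l] makes affinity hold at every index, while [phi j] is controlled only for
   [j <= l]. *)
pose F j (L : d.-tuple R -> R) : R :=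
  if (j <= l)%N then fine (mom_P a g0 phi j L) else 0.
pose Fn n w j (L : d.-tuple R -> R) : R :=
  n%:R^-1 * \sum_(i < n) phi j (X i w) * L (X i w).
have bounded (j : 'I_l.+1) : exists K, forall f, shape_class a g0 M gamma f ->
    weight_integral a g0 (fun x => phi j x * (f x / g0 x)) \is a fin_num /\
    `|fine (weight_integral a g0 (fun x => phi j x * (f x / g0 x)))| <= K.
  have jl : (j <= l)%N by rewrite -ltnS.
  exact: (weight_integral_shape_bounded hg0 hM hgamma hX (hphi j jl) hdelta
    (hnorm j jl)).
have /choice[Kj KjP] := bounded.
pose K := \sum_j `|Kj j|.
have FE j L : (j <= l)%N -> S L -> mom_P a g0 phi j L = (F j L)%:E.
  move=> jl [f Sf <-]; rewrite /F jl.
  by have [+ _] := KjP (Ordinal (jl : (j < l.+1)%N)) f Sf; move/fineK => ->.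
have FK j L : (j <= l)%N -> S L -> `|F j L| <= K.
  move=> jl [f Sf <-]; rewrite /F jl; pose j' := Ordinal (jl : (j < l.+1)%N).
  have [_ +] := KjP j' f Sf; move/le_trans; apply.
  rewrite (le_trans (ler_norm _))// /K (bigD1 j')//= lerDl.
  exact: sumr_ge0.
have ulln (eta : R) : 0 < eta -> eventually_as P (fun n w =>
    forall j L, (j <= l)%N -> S L -> `|Fn n w j L - F j L| <= eta).
  move=> eta0.
  have unif (j : 'I_l.+1) : eventually_as P (fun n w => forall f,
      shape_class a g0 M gamma f ->
      `|n%:R^-1 * (\sum_(i < n) phi j (X i w) * (f (X i w) / g0 (X i w))) -
        fine (weight_integral a g0 (fun x => phi j x * (f x / g0 x)))| <= eta).
    have jl : (j <= l)%N by rewrite -ltnS.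
    exact: (uniform_law_shape hg0 hM hgamma hX (hphi j jl) hdelta (hnorm j jl)).
  apply: eventually_as_mono (eventually_as_forall unif) => n w n0 H j L jl.
  move=> [f Sf <-]; rewrite /F jl.
  exact: (H (Ordinal (jl : (j < l.+1)%N)) f Sf).
have Fna n w j : affine_on S (Fn n w j).
  move=> t L L' _ _ _; rewrite /Fn [t * (_ * _)]mulrCA [(1 - t) * (_ * _)]mulrCA.
  rewrite -mulrDr; congr (_ * _); rewrite !mulr_sumr -big_split/=.
  apply: eq_bigr => i _; set x := X i w.
  by rewrite -[(_ + _) x]/(t * L x + (1 - t) * L' x); ring.
(* Members of [S] need not be measurable, so linearity of the integral does not
   apply; affinity passes to the limit from the empirical moments instead. *)
have Fa j : affine_on S (F j).
  have [jl|lj] := leqP j l; last first.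
    by move=> t L L' _ _ _; rewrite /F leqNgt lj /= !mulr0 addr0.
  move=> t L L' t01 SL SL'; have /andP[t0 t1] := t01.
  apply/eqP; rewrite -subr_eq0 -normr_le0; apply/ler_addgt0Pl => e e0.
  rewrite addr0; have e30 : 0 < e / 3 by exact: divr_gt0.
  have [n [w H]] := eventually_as_inhabited (ulln _ e30).
  have := H j _ jl (Sconv _ _ _ t01 SL SL').
  have := H j _ jl SL; have := H j _ jl SL'; rewrite Fna//.
  move: (F j (_ + _)) (F j L) (F j L') (Fn n w j L) (Fn n w j L').
  move=> u v v' y y' h' h hu.
  have {}h : `|t * (y - v)| <= e / 3.
    by rewrite normrM (ger0_norm t0) (le_trans _ h)// ler_piMl.
  have {}h' : `|(1 - t) * (y' - v')| <= e / 3.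
    by rewrite normrM ger0_norm ?subr_ge0// (le_trans _ h')// ler_piMl// gerBl.
  have -> : u - (t * v + (1 - t) * v') = t * (y - v) + (1 - t) * (y' - v') -
      (t * y + (1 - t) * y' - u) by ring.
  move: h h' hu; rewrite !ler_norml.
  move: (t * _) ((1 - t) * _) (_ - u) => p q r.
  by move=> /andP[? ?] /andP[? ?] /andP[? ?]; apply/andP; split; lra.
have [L0 SL0 [L0ineq L0eq]] := hslater.
have ball : exists2 r, 0 < r & forall v : nat -> R,
    (forall j, (m < j <= l)%N -> `|v j - mu j| <= r) ->
    exists2 L, S L & forall j, (m < j <= l)%N -> F j L = v j.
  (* If [m = l] there is no equality to satisfy, and [L0] serves for every [v]. *)
  have [ml|lm] := ltnP m l; last first.
    exists 1 => // v _; exists L0 => // j /andP[mj jl].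
    by have := leq_trans mj (leq_trans jl lm); rewrite ltnn.
  have /nbhs_ballP[r /= r0 Hr] := hint ml.
  (* Half the radius, because the ball is open whereas [v] is only within a non-strict distance of
     [mu]. *)
  exists (r / 2) => [|v Hv]; first exact: divr_gt0.
  have jP (k : 'I_(l - m)) : (m < m + k.+1 <= l)%N.
    by have := ltn_ord k; lia.
  have [|L SL HL] := Hr (\row_k v (m + k.+1)%N).
    split=> // i k; rewrite !mxE -ball_normE/= distrC (le_lt_trans (Hv _ (jP k)))//.
    by rewrite ltr_pdivrMr// ltr_pMr// ltr1n.
  exists L => // j /andP[mj jl].
  have kl : (j - m.+1 < l - m)%N by lia.
  have jE : j = (m + (Ordinal kl).+1)%N by rewrite /=; lia.
  apply: EFin_inj; rewrite -FE// [in LHS]jE HL mxE -jE//.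
have [r r0 Hr] := ball.
have [||rho rho0 rob] := robustly_feasible_slater hml Sconv Fa FK SL0
  _ _ r0 Hr.
- move=> j j1m; have jl : (j <= l)%N by case/andP: j1m => _ /leq_trans; apply.
  by have := L0ineq j j1m; rewrite FE.
- move=> j jml; have jl : (j <= l)%N by case/andP: jml.
  by have := L0eq j jml; rewrite FE// => -[].
apply: as_star_cvg_eventually => eta eta0.
have [Delta D0 HD] := optval_stable hml Sconv FE Fa FK rho0 rob eta0.
apply: eventually_as_mono (ulln _ D0) => n w _ H.
by apply: (HD (Fn n w)).
Qed.
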